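(* For every $\epsilon > 0$, there is a deterministic distributed algorithm in the LOCAL model that, run on an $n$-node interval graph $H$, computes an independent set $I$ of $H$ with $\alpha(H) \le (1+\epsilon)|I|$ in $\mathrm{O}(\frac{1}{\epsilon}\log^* n)$ rounds.
   Context: An interval graph is the intersection graph of a finite family of intervals on the real line. $\alpha(H)$ denotes the maximum size of an independent set in $H$. In the LOCAL model, the input graph is the communication network; each node has a unique ID and initially knows only its own ID and its neighbors. Computation proceeds in synchronous rounds; in each round every node performs unlimited local computation and then sends messages of unbounded size to each of its neighbors. The running time is the number of rounds. At termination every node must know whether it belongs to the output independent set.
   Formalization: IDs are assumed to lie in {1,…,n^c} for an arbitrary constant c, on which the O-constant may depend (with unbounded IDs the claim fails), and the round bound is O(max(1,1/ε)·log* n), since for large ε the literal bound would force zero rounds. *)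

(* Defs.v *)
From HB Require Import structures.
From mathcomp Require Import all_boot all_order all_algebra.
From mathcomp Require Import all_classical all_reals all_analysis.
Set Implicit Arguments.
Unset Strict Implicit.
Unset Printing Implicit Defensive.
Import Order.TTheory GRing.Theory Num.Theory.
Local Open Scope classical_set_scope.
Local Open Scope ring_scope.

Definition interval_graph (R : realType) (T : finType) (e : rel T) : Prop :=
  exists J : T -> set R,
    (forall v, is_interval (J v)) /\
    (forall u v, e u v <-> u <> v /\ J u `&` J v !=set0).

Definition independent (T : finType) (e : rel T) (S : {set T}) : bool :=
  [forall u in S, forall v in S, ~~ e u v].

Definition independence_number (T : finType) (e : rel T) : nat :=
  (\max_(S : {set T} | independent e S) #|S|)%N.

Definition log2 (R : realType) (x : R) : R := ln x / ln 2.

Lemma iter_log2_le1 (R : realType) (n : nat) :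
  exists k, iter k (@log2 R) n%:R <= 1.
Proof.
suff H m (x : R) : x <= m.+1%:R -> exists k, iter k (@log2 R) x <= 1.
  by apply: (H n); rewrite ler_nat.
elim: m x => [|m IHm] x xm; first by exists 0%N.
have [x1|x1] := leP x 1; first by exists 0%N.
have x0 : 0 < x by apply: lt_trans x1.
have [|k kx] := IHm (log2 x); last by exists k.+1; rewrite iterSr.
rewrite /log2 ler_pdivrMr ?ln_gt0 ?ltr1n// mulr_natl -lnXn ?ltr0n//.
rewrite ler_ln ?posrE ?exprn_gt0 ?ltr0n//.
by apply: (le_trans xm); rewrite -natrX ler_nat ltn_expl.
Qed.

(* log* n: the number of times log2 must be iterated, starting from n, before
   the value drops to at most 1. *)
Definition log_star (R : realType) (n : nat) : nat :=
  ex_minn (iter_log2_le1 R n).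

(* A deterministic algorithm for the LOCAL model. A node starts from its own ID
   and the IDs of its neighbours, and from nothing else (in particular it is not
   given the number of nodes). A message may depend on the ID of its addressee,
   and an inbox lists each message with the ID of its sender. The output is None
   as long as the node is undecided; a decision is irrevocable, but a decided
   node may go on relaying messages. *)
Record local_algorithm := LocalAlgorithm {
  la_state : Type;
  la_message : Type;
  la_init : nat -> seq nat -> la_state;
  la_send : la_state -> nat -> la_message;
  la_receive : la_state -> seq (nat * la_message) -> la_state;
  la_output : la_state -> option bool;
  la_output_stable : forall s inbox b,
    la_output s = Some b -> la_output (la_receive s inbox) = Some b
}.

Section Execution.
Variables (T : finType) (e : rel T) (ids : T -> nat) (A : local_algorithm).

(* Listed by increasing ID, so that the enumeration of T conveys nothing. *)
Definition neighbours (v : T) : seq T :=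
  sort (fun u w => ids u <= ids w)%N (enum (e v)).

(* The state of each node after t rounds. *)
Fixpoint run (t : nat) : T -> la_state A :=
  if t is t'.+1 then
    fun v => la_receive (run t' v)
               [seq (ids w, la_send (run t' w) (ids v)) | w <- neighbours v]
  else
    fun v => la_init A (ids v) [seq ids w | w <- neighbours v].

Definition terminated (t : nat) : Prop :=
  forall v, la_output (run t v) <> None.

Definition output_set (t : nat) : {set T} :=
  [set v | la_output (run t v) == Some true].

End Execution.

(* Unique IDs taken from {1, ..., n ^ c}, with n the number of nodes. *)
Definition valid_ids (c : nat) (T : finType) (ids : T -> nat) : Prop :=
  injective ids /\ forall v, (1 <= ids v <= #|T| ^ c)%N.

(* Main.v *)
Require Import Defs.
From mathcomp Require Import all_boot all_order all_algebra.
From mathcomp Require Import all_classical all_reals all_analysis.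
From mathcomp Require Import zify lra.
Set Implicit Arguments.
Unset Strict Implicit.
Unset Printing Implicit Defensive.
Import Order.TTheory GRing.Theory Num.Theory.
Local Open Scope classical_set_scope.

(* Put q = floor (1 / eps) + 1 and k = 4 q + 1. The k-th power of an interval
   graph is an interval graph, and in it one computes an independent set of
   centers that is O(log* n)-dominating. Starting from the IDs as a proper
   colouring, a round takes the local maxima (peaks) as centers, discards their
   neighbours, and recolours each remaining node that is the maximum of some
   neighbour's neighbourhood by the highest bit in which its colour differs from
   the largest colour around it; among adjacent nodes with equal new colours
   only the one of largest old colour is kept. The colours shrink from N to
   log N, and the linear structure of intervals shows that every node has a
   peak or a surviving node within distance 6.

   A maximal clique is the set of intervals through a point, so deleting a
   maximal clique through each center cuts the graph into pieces of weak
   diameter O(k log* n), each of which is solved exactly. An optimal solution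
   loses at most one node per deleted clique, whereas each center whose clique
   is deleted accounts for q + 1 nodes of an independent set near it.

   The result is a function of the graph that, at each node, is determined by a
   ball of radius O(k log* n). A node need not know this radius: it collects its
   neighbourhood and decides as soon as all graphs consistent with what it has
   seen give it the same answer. *)

(** * Balls and powers of interval graphs *)

(** Graphs are relations on the natural numbers, with IDs as nodes, so that two graphs can be
    compared at the same node. *)
Fixpoint reach (g : nat -> nat -> Prop) (n x y : nat) : Prop :=
  if n is m.+1 then reach g m x y \/ exists2 z, reach g m x z & g z y else x = y.

Lemma reach_refl g n x : reach g n x x.
Proof. by elim: n => [|n IH] //=; left. Qed.

Lemma reach_leq g m n x y : m <= n -> reach g m x y -> reach g n x y.
Proof.
elim: n => [|n IH]; first by rewrite leqn0 => /eqP ->.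
by rewrite leq_eqVlt => /orP[/eqP -> //|mn /(IH mn)]; left.
Qed.

Lemma reach_trans g m n x y z :
  reach g m x y -> reach g n y z -> reach g (m + n) x z.
Proof.
move=> xy; elim: n z => [|n IH] z /=; first by rewrite addn0 => <-.
rewrite addnS /= => -[/IH|[w /IH]]; [by left|by right; exists w].
Qed.

Lemma reach_edge (g : nat -> nat -> Prop) x y : g x y -> reach g 1 x y.
Proof. by right; exists x. Qed.

Lemma reach_split g m n x z :
  reach g (m + n) x z -> exists2 y, reach g m x y & reach g n y z.
Proof.
elim: n z => [|n IH] z /=; first by rewrite addn0; exists z.
rewrite addnS /= => -[/IH[y xy yz]|[w /IH[y xy yw] wz]]; exists y => //.
  by left.
by right; exists w.
Qed.

Lemma reach_sym g n x y : (forall u v, g u v -> g v u) ->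
  reach g n x y -> reach g n y x.
Proof.
move=> gs; elim: n y => [|n IH] y // [/IH|[z /IH zx /gs yz]].
  by left.
by rewrite -add1n; apply: reach_trans zx; apply: reach_edge.
Qed.

Lemma reach_last_edge g n x y : reach g n x y -> x <> y -> exists z, g z y.
Proof.
by elim: n => [|n IH] //= [/IH //|[z _ zy] _]; exists z.
Qed.

Definition power (g : nat -> nat -> Prop) (k x y : nat) : Prop :=
  x <> y /\ reach g k x y.

Lemma reach_power g k n x y : reach (power g k) n x y -> reach g (k * n) x y.
Proof.
elim: n y => [|n IH] y; first by rewrite muln0.
rewrite mulnS addnC /= => -[/IH|[z /IH xz [_ zy]]].
  by apply: reach_leq; rewrite leq_addr.
exact: reach_trans xz zy.
Qed.

Definition represents (R : realType) (J : nat -> set R) (g : nat -> nat -> Prop) :=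
  (forall x, is_interval (J x)) /\
  (forall x y, g x y <-> x <> y /\ J x `&` J y !=set0).

Section Geometry.
Local Open Scope ring_scope.
Variables (R : realType) (J : nat -> set R) (g : nat -> nat -> Prop).
Hypothesis Jg : represents J g.

Lemma rep_sym x y : g x y -> g y x.
Proof.
move/Jg.2 => [xy [t [xt yt]]]; apply/Jg.2; split; first exact: nesym.
by exists t.
Qed.

Lemma rep_edge x y s : J x s -> J y s -> x = y \/ g x y.
Proof.
move=> xs ys; have [->|xy] := pselect (x = y); first by left.
by right; apply/Jg.2; split => //; exists s.
Qed.

Lemma rep_meet x y : g x y -> exists2 s, J x s & J y s.
Proof. by move/Jg.2 => [_ [s [? ?]]]; exists s. Qed.

Lemma rep_convex x a b s : J x a -> J x b -> a <= s -> s <= b -> J x s.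
Proof. by move=> xa xb sa sb; apply: (Jg.1 x a b) => //; apply/andP. Qed.

Lemma rep_convex2 x a b s : J x a -> J x b ->
  (a <= s /\ s <= b) \/ (b <= s /\ s <= a) -> J x s.
Proof. move=> xa xb [[? ?]|[? ?]]; first exact: (rep_convex xa xb).
exact: (rep_convex xb xa). Qed.

(** Consecutive intervals of a walk overlap, so the walk leaves no gap between [a] and [b]. *)
Lemma reach_cover n x y a b s : reach g n x y -> J x a -> J y b ->
  (a <= s /\ s <= b) \/ (b <= s /\ s <= a) -> exists2 z, reach g n x z & J z s.
Proof.
elim: n y b => [|n IH] y b /=.
  by move=> <- xa xb sab; exists x => //; apply: rep_convex2 sab.
move=> [xy|[w xw wy]] xa yb sab.
  by have [z xz zs] := IH _ _ xy xa yb sab; exists z => //; left.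
have [c wc yc] := rep_meet wy.
have [acs|cbs] : ((a <= s /\ s <= c) \/ (c <= s /\ s <= a)) \/
                 ((c <= s /\ s <= b) \/ (b <= s /\ s <= c)).
- by case/orP: (le_total s c) => sc; case: sab => -[? ?]; tauto.
- by have [z xz zs] := IH _ _ xw xa wc acs; exists z => //; left.
- by exists y; [right; exists w|exact: rep_convex2 cbs].
Qed.

(** The intervals met by the ball of radius r fill an interval, by [reach_cover]; two such unions
    share a point when r + 1 + r steps lead from one node to the other. *)
Lemma power_represents r :
  represents (fun x => [set s | exists2 y, reach g r x y & J y s])
             (power g (r + r.+1)).
Proof.
split=> [x a b [y xy ya] [z xz zb] s /andP[sa sb]|x y].
  have [xy0|yx] := pselect (x = y).
    by apply: (reach_cover xz (a := a) (b := b)); [rewrite xy0|by []|left].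
  have [w wy] := reach_last_edge xy yx.
  (* [a] and [b] may lie in different intervals of the ball, so [s] is reached from a point [p] of
     [J x], going right towards [b] or left towards [a]. *)
  have [p xp] : J x !=set0.
    have [v vx] : exists v, g v x.
      by apply: (reach_last_edge (reach_sym rep_sym xy)); apply: nesym.
    by have [p _ ?] := rep_meet vx; exists p.
  have [ps|sp] := leP p s.
    by apply: (reach_cover xz xp zb); left.
  by apply: (reach_cover xy xp ya); right; rewrite (ltW sp).
split=> [[xy /reach_split[a xa]] /= ay|[xy [s [[a xa sa] [b yb sb]]]]].
  split => //; have /= ya := reach_sym rep_sym (ay : reach g r.+1 a y).
  case: ya => [ya|[b yb /rep_meet[s ? ?]]]; last first.
    by exists s; split; [exists a|exists b].
  have [c /rep_meet[s _ sa]] : exists c, g c a.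
    have [xa0|nxa] := pselect (x = a); last exact: reach_last_edge xa nxa.
    by apply: (reach_last_edge ya) => ya0; apply: xy; rewrite xa0.
  by exists s; split; exists a.
split => //; rewrite -addn1 addnA addnAC; apply: reach_trans (reach_sym rep_sym yb).
by apply: reach_trans xa _; have [->|?] := rep_edge sa sb; [left|exact: reach_edge].
Qed.

(** An empty interval is vacuously before and after everything, hence the nonemptiness assumptions
    below. *)
Definition before (x y : nat) : Prop := forall s t, J x s -> J y t -> s < t.

Lemma before_total x y : ~ (exists2 s, J x s & J y s) -> before x y \/ before y x.
Proof.
move=> dis; have [|nb] := pselect (before x y); [by left|right].
move: nb => /existsNP[s /existsNP[t /not_implyP[xs /not_implyP[yt /negP]]]].
rewrite -leNgt => ts s' t' ys' xt'; rewrite ltNge; apply/negP => ts'.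
apply: dis; have [tt'|t't] := leP t t'.
  by exists t' => //; apply: rep_convex yt ys' _ _.
by exists t => //; apply: rep_convex xt' xs _ _ => //; apply: ltW.
Qed.

End Geometry.

Lemma ex_bounded_max (P : nat -> Prop) (l : nat -> nat) (B : nat) :
  (exists x, P x) -> (forall x, P x -> l x < B) ->
  exists2 x, P x & forall y, P y -> l y <= l x.
Proof.
elim: B => [[x Px] /(_ x Px)//|B IH] exP lB.
have [[x [Px xB]]|nB] := pselect (exists x, P x /\ l x = B).
  by exists x => // y /lB; rewrite xB.
apply: IH => // x Px; have := lB x Px; rewrite ltnS leq_eqVlt => /orP[/eqP xB|//].
by exfalso; apply: nB; exists x.
Qed.

(** * One round of colour reduction *)

Lemma topbit_exists a b : exists j, a %/ 2 ^ j.+1 == b %/ 2 ^ j.+1.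
Proof.
have bnd m n : m <= n -> m %/ 2 ^ n.+1 = 0.
  by move=> mn; rewrite divn_small // (leq_ltn_trans mn) // ltnW // ltn_expl.
by exists (maxn a b); rewrite !bnd ?leq_maxl ?leq_maxr.
Qed.

(* The position of the highest bit in which a and b differ (0 if a = b). *)
Definition topbit (a b : nat) : nat := ex_minn (topbit_exists a b).

Lemma topbit_div a b : a %/ 2 ^ (topbit a b).+1 = b %/ 2 ^ (topbit a b).+1.
Proof. by rewrite /topbit; case: ex_minnP => j /eqP. Qed.

Lemma topbit_bound a b e : a < 2 ^ e -> b < 2 ^ e -> a <> b -> topbit a b < e.
Proof.
case: e => [|e] ae be ab.
  by move: ae be ab; rewrite expn0 !ltnS !leqn0 => /eqP -> /eqP ->.
rewrite /topbit ltnS; case: ex_minnP => j _; apply.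
by rewrite !divn_small.
Qed.

Lemma topbit_div_lt a b : a < b -> a %/ 2 ^ topbit a b < b %/ 2 ^ topbit a b.
Proof.
move=> ab; rewrite ltn_neqAle leq_div2r 1?ltnW // andbT.
rewrite /topbit; case: ex_minnP => -[|j] _ jmin.
  by rewrite expn0 !divn1 neq_ltn ab.
by apply/negP => /jmin; rewrite ltnn.
Qed.

(** At the common top bit, a and c have 0 while b has 1; above it a, b and c agree. *)
Lemma topbit_lt a b c d : a < b -> c < d -> topbit a b = topbit c d ->
  a %/ 2 ^ (topbit a b).+1 = c %/ 2 ^ (topbit a b).+1 -> c < b.
Proof.
move=> ab cd E; have := topbit_div a b; have := topbit_div c d.
have := topbit_div_lt ab; have := topbit_div_lt cd; rewrite -E.
rewrite expnS mulnC !divnMA; set p := 2 ^ _ => cdp abp cd2 ab2 ac2.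
have cbp : c %/ p < b %/ p by lia.
by rewrite ltnNge; apply: contraL cbp => bc; rewrite -leqNgt leq_div2r.
Qed.

Section Peeling.
Variable g : nat -> nat -> Prop.
Implicit Types (L : nat -> Prop) (l : nat -> nat).

Definition closed_nbhd L u x := L x /\ (x = u \/ g u x).

(** Taken by [xget] because an arbitrary relation on the numbers may have no maximum here; 0 is the
    default. *)
Definition max_label L l u : nat :=
  xget 0 [set n | (exists2 x, closed_nbhd L u x & l x = n) /\
                  forall y, closed_nbhd L u y -> l y <= n].

Definition peak L l u := L u /\ forall x, closed_nbhd L u x -> l x <= l u.

Definition new_label L l u := topbit (l u) (max_label L l u).

Definition marked L l u :=
  [/\ L u, ~ peak L l u &
      exists2 v, closed_nbhd L u v & forall x, closed_nbhd L v x -> l x <= l u].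

Definition survivor L l u :=
  [/\ marked L l u, forall x, peak L l x -> ~ g u x &
      forall x, marked L l x -> g u x -> new_label L l x = new_label L l u ->
        l x <= l u].

(** Level 0 leaves out isolated numbers, among them those that are no ID. *)
Fixpoint level (i : nat) : (nat -> Prop) * (nat -> nat) :=
  if i is j.+1 then
    (survivor (level j).1 (level j).2, new_label (level j).1 (level j).2)
  else (fun x => exists y, g x y, id).

Definition level_peak i := peak (level i).1 (level i).2.

(** Without a cut-off on the level, this does not refer to the number of nodes, which no node
    knows. *)
Definition center x := exists i, level_peak i x.

Section Step.
Variables (R : realType) (J : nat -> set R).
Hypothesis Jg : represents J g.
Variables (L : nat -> Prop) (l : nat -> nat) (B : nat).
Hypothesis lB : forall x, L x -> l x < B.
Hypothesis l_proper : forall x y, L x -> L y -> g x y -> l x <> l y.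
Hypothesis L_nonempty : forall x, L x -> J x !=set0.

Let gs := rep_sym Jg.

Lemma max_labelP u : L u ->
  (exists2 x, closed_nbhd L u x & l x = max_label L l u) /\
  forall y, closed_nbhd L u y -> l y <= max_label L l u.
Proof.
move=> Lu; rewrite /max_label; case: xgetP => [_ -> //|noP].
have [||x ux xmax] := @ex_bounded_max (closed_nbhd L u) l B.
- by exists u; split => //; left.
- by move=> x [/lB].
by exfalso; apply: (noP (l x)); split => //; exists x.
Qed.

Lemma nonpeak_lt u : L u -> ~ peak L l u -> l u < max_label L l u.
Proof.
move=> Lu up; have [_ umax] := max_labelP Lu.
rewrite ltnNge; apply/negP => mu; apply: up; split => // x /umax.
by move/leq_trans; apply.
Qed.

Lemma new_label_lt u e : L u -> ~ peak L l u -> B <= 2 ^ e ->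
  new_label L l u < e.
Proof.
move=> Lu up Be; have lt := nonpeak_lt Lu up.
have [[x [Lx _] xE] _] := max_labelP Lu.
apply: topbit_bound; first exact: leq_trans (lB Lu) Be.
  by rewrite -xE; exact: leq_trans (lB Lx) Be.
by move=> E; rewrite -E ltnn in lt.
Qed.

Lemma peak_indep x y : peak L l x -> peak L l y -> ~ g x y.
Proof.
move=> [Lx xmax] [Ly ymax] xy; apply: (l_proper Lx Ly xy).
apply/eqP; rewrite eqn_leq ymax ?xmax //; split => //; right => //.
exact: gs.
Qed.

Lemma survivor_proper x y : survivor L l x -> survivor L l y -> g x y ->
  new_label L l x <> new_label L l y.
Proof.
move=> [mx _ xmax] [my _ ymax] xy E; have [Lx _ _] := mx; have [Ly _ _] := my.
apply: (l_proper Lx Ly xy); apply/eqP; rewrite eqn_leq ymax ?xmax //.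
exact: gs.
Qed.

(* A node all of whose neighbours have smaller labels than q is a wall for the
   labels above l q, so between two such walls a node of largest label is a
   peak. *)
Lemma trapped_peak a b q : L a -> L b -> L q ->
  (forall x, closed_nbhd L a x -> l x < l q) ->
  (forall x, closed_nbhd L b x -> l x < l q) ->
  before J a q -> before J q b ->
  exists w, [/\ peak L l w, before J a w & before J w b].
Proof.
move=> La Lb Lq wa wb aq qb.
have [[sa Jsa] [sb Jsb]] := (L_nonempty La, L_nonempty Lb).
have [||w [Lw qw aw wb'] wmax] := @ex_bounded_max
  (fun w => [/\ L w, l q <= l w, before J a w & before J w b]) l B.
- by exists q.
- by move=> x [/lB].
exists w; split => //; split => // x [Lx [->//|wx]].
have [sx xs ws] := rep_meet Jg (gs wx).
rewrite leqNgt; apply/negP => wlx.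
have qx : l q <= l x by apply: leq_trans qw (ltnW wlx).
(* The walls keep [x] off [a] and [b], so [x] lies between them too and contradicts the choice of
   [w]. *)
have far c : L c -> (forall x, closed_nbhd L c x -> l x < l q) ->
    ~ (exists2 s, J x s & J c s).
  move=> Lc wc [s xs' cs]; have := wc x; rewrite ltnNge qx; move=> /(_ _)/negP.
  case=> //; split=> //; have [->|?] := rep_edge Jg cs xs'; by [left|right].
suff : l x <= l w by rewrite leqNgt wlx.
apply: wmax; split => //.
  case: (before_total Jg (far a La wa)) => // xa.
  by have := lt_trans (xa _ _ xs Jsa) (aw _ _ Jsa ws); rewrite ltxx.
case: (before_total Jg (far b Lb wb)) => // bx.
by have := lt_trans (bx _ _ Jsb xs) (wb' _ _ ws Jsb); rewrite ltxx.
Qed.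

(** A node of largest label around [u] works: [u] itself witnesses its mark. *)
Lemma max_nbr_peak_or_marked u : L u ->
  exists2 w, closed_nbhd L u w & peak L l w \/ marked L l w.
Proof.
move=> Lu; have [[w uw wE] umax] := max_labelP Lu; exists w => //.
have [|wp] := pselect (peak L l w); [by left|right; split=> //].
  by case: uw.
exists u => [|x /umax]; last by rewrite wE.
by split => //; case: uw => _ [->|/gs ?]; [left|right].
Qed.

(** The obstacles that keep a marked [u] without adjacent peak from surviving. *)
Definition better u x :=
  [/\ marked L l x, g u x, new_label L l x = new_label L l u & l u < l x].

Definition best u x := better u x /\ forall y, better u y -> l y <= l x.

Lemma best_or_done u : marked L l u ->
  (exists2 z, reach g 1 u z & peak L l z \/ survivor L l z) \/
  exists x, best u x.
Proof.
move=> mu; have [bu|nbu] := pselect (exists x, better u x).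
  right; have [|x ux xmax] := @ex_bounded_max (better u) l B bu; last by exists x.
  by move=> x [[/lB]].
left; have [[x xp ux]|np] := pselect (exists2 x, peak L l x & g u x).
  by exists x; [exact: reach_edge|left].
exists u; first exact: reach_refl.
right; split => // [x xp ux|x mx ux E]; first by apply: np; exists x.
by rewrite leqNgt; apply/negP => ulx; apply: nbu; exists x.
Qed.

(** Makes chains of best steps induced paths: if a later node were adjacent to [a], it would have
    been preferred to [b]. *)
Lemma best_nonadj a b x : best a b -> marked L l x ->
  new_label L l x = new_label L l a -> l b < l x -> ~ g a x.
Proof.
move=> [[_ _ _ ab] bmax] mx E bx ax.
have /bmax : better a x by split => //; exact: ltn_trans bx.
by rewrite leqNgt bx.
Qed.

(** Each node sees the other, so each label is at most the largest label around the other; above the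
    common bit a label agrees with that largest label, which gives both inequalities. *)
Lemma same_prefix u x : marked L l u -> marked L l x -> g u x ->
  new_label L l x = new_label L l u ->
  l x %/ 2 ^ (new_label L l u).+1 = l u %/ 2 ^ (new_label L l u).+1.
Proof.
move=> [Lu _ _] [Lx _ _] ux E.
have [_ umax] := max_labelP Lu; have [_ xmax] := max_labelP Lx.
have ux' : l u <= max_label L l x by apply: xmax; split => //; right; exact: gs.
have xu' : l x <= max_label L l u by apply: umax; split => //; right.
have Pu := topbit_div (l u) (max_label L l u).
have Px := topbit_div (l x) (max_label L l x).
rewrite -!/(new_label L l _) E in Pu Px.
by apply/eqP; rewrite eqn_leq {1}Pu {2}Px !leq_div2r.
Qed.

Lemma before_of_lt a b s t : ~ (exists2 s, J a s & J b s) -> J a s -> J b t ->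
  (s < t)%R -> before J a b.
Proof.
move=> /(before_total Jg)[//|ba] as_ bt st.
by have := lt_trans st (ba _ _ bt as_); rewrite ltxx.
Qed.

Lemma between_meets a b c d : g b a -> g b c -> J d !=set0 ->
  before J a d -> before J d c -> exists2 s, J b s & J d s.
Proof.
move=> ba bc [t dt] ad dc.
have [[s bs as_] [r br cr]] := (rep_meet Jg ba, rep_meet Jg bc).
exists t => //; apply: (rep_convex Jg bs br); apply: ltW; [exact: ad|exact: dc].
Qed.

(* Along a chain of best steps of length 4 the ends have walls; the largest
   neighbour of the middle node lies between them, since otherwise both ends of
   the induced path would be on the same side of its middle. *)
Lemma long_chain_peak u0 u1 u2 u3 u4 : marked L l u0 ->
  best u0 u1 -> best u1 u2 -> best u2 u3 -> best u3 u4 ->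
  exists2 w, reach g 5 u0 w & peak L l w.
Proof.
move=> m0 b01 b12 b23 b34.
have [[m1 g01 E1 l01] _] := b01; have [[m2 g12 E2 l12] _] := b12.
have [[m3 g23 E3 l23] _] := b23; have [[m4 g34 E4 l34] _] := b34.
have disj a x : a <> x -> ~ g a x -> ~ (exists2 s, J a s & J x s).
  by move=> ax nax [s as_ xs]; case: (rep_edge Jg as_ xs).
have lneq a x : l a < l x -> a <> x by move=> ax E; rewrite E ltnn in ax.
have d02 : ~ (exists2 s, J u0 s & J u2 s).
  apply: disj; first by apply: lneq; lia.
  by apply: (best_nonadj b01) => //; congruence.
have d03 : ~ (exists2 s, J u0 s & J u3 s).
  apply: disj; first by apply: lneq; lia.
  by apply: (best_nonadj b01) => //; [congruence|lia].
have d04 : ~ (exists2 s, J u0 s & J u4 s).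
  apply: disj; first by apply: lneq; lia.
  by apply: (best_nonadj b01) => //; [congruence|lia].
have d14 : ~ (exists2 s, J u1 s & J u4 s).
  apply: disj; first by apply: lneq; lia.
  by apply: (best_nonadj b12) => //; [congruence|lia].
have d24 : ~ (exists2 s, J u2 s & J u4 s).
  apply: disj; first by apply: lneq; lia.
  by apply: (best_nonadj b23) => //; congruence.
have [[L0 _ [v0 [Lv0 v0u] v0max]] [L4 _ [v4 [Lv4 v4u] v4max]]] := (m0, m4).
have [L2 np2 _] := m2; have [L3 np3 _] := m3.
have [[q [Lq qu2] qE] _] := max_labelP L2.
(* The chain shares one new label and one prefix above that bit; at the bit, [q] has 1 and [u4] has
   0. *)
have l4q : l u4 < l q.
  rewrite qE; apply: (topbit_lt (a := l u2) (d := max_label L l u4)).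
  - exact: nonpeak_lt.
  - by apply: nonpeak_lt => //; case: m4.
  - by rewrite -/(new_label L l u2) -/(new_label L l u4); congruence.
  - rewrite -/(new_label L l u2); apply: esym.
    rewrite -(same_prefix m2 m3 g23 E3) -E3; exact: same_prefix.
have wall v u : L v -> l u < l q -> (forall x, closed_nbhd L v x -> l x <= l u) ->
    (forall x, closed_nbhd L v x -> l x < l q) /\ ~ (exists2 s, J v s & J q s).
  move=> Lv luq vmax; split=> [x /vmax xu|[s vs qs]].
    exact: leq_ltn_trans xu luq.
  suff /vmax : closed_nbhd L v q by rewrite leqNgt luq.
  by split => //; case: (rep_edge Jg vs qs) => [->|]; [left|right].
have [w0 dv0] := wall v0 u0 Lv0 ltac:(lia) v0max.
have [w4 dv4] := wall v4 u4 Lv4 l4q v4max.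
have meet a b : L a -> b = a \/ g a b -> exists2 s, J a s & J b s.
  move=> La [->|/(rep_meet Jg)//].
  by have [s ?] := L_nonempty La; exists s.
have [r u0r v0r] := meet _ _ L0 v0u; have [t u4t v4t] := meet _ _ L4 v4u.
have [z u2z qz] := meet _ _ L2 qu2.
(* Four steps lead from [u0] to [u4] and cover everything between [r] and [t]; a fifth reaches
   [w]. *)
have trap w s : J w s -> (r <= s /\ s <= t)%R \/ (t <= s /\ s <= r)%R ->
    reach g 5 u0 w.
  move=> ws rst; have u04 : reach g 4 u0 u4.
    by right; exists u3 => //; right; exists u2 => //; right; exists u1 => //;
       exact: reach_edge.
  have [y u0y ys] := reach_cover Jg u04 u0r u4t rst.
  by case: (rep_edge Jg ys ws) => [<-|]; [left|right; exists y].
have [n0 n4] := (L_nonempty L0, L_nonempty L4).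
case: (before_total Jg dv0) => vq0; case: (before_total Jg dv4) => vq4.
(* Walls on the same side of [q] put [u0] and [u4] on the same side of [u2]; then [u1] meets [u4] or
   [u3] meets [u0], although the path is induced. *)
- have b02 : before J u0 u2 by apply: before_of_lt u0r u2z (vq0 _ _ v0r qz).
  have b42 : before J u4 u2.
    by apply: before_of_lt u4t u2z (vq4 _ _ v4t qz) => -[s ? ?]; apply: d24; exists s.
  case: (before_total Jg d04) => b04; exfalso.
    exact/d14/(between_meets (gs g01) g12 n4 b04 b42).
  have [s ? ?] := between_meets g34 (gs g23) n0 b04 b02.
  by apply: d03; exists s.
- have [w [wp v0w wv4]] := trapped_peak Lv0 Lv4 Lq w0 w4 vq0 vq4.
  exists w => //; have [s ws] := L_nonempty wp.1.
  by apply: (trap w s ws); left; split; apply: ltW; [exact: v0w|exact: wv4].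
- have [w [wp v4w wv0]] := trapped_peak Lv4 Lv0 Lq w4 w0 vq4 vq0.
  exists w => //; have [s ws] := L_nonempty wp.1.
  by apply: (trap w s ws); right; split; apply: ltW; [exact: v4w|exact: wv0].
- have b20 : before J u2 u0.
    by apply: before_of_lt u2z u0r (vq0 _ _ qz v0r) => -[s ? ?]; apply: d02; exists s.
  have b24 : before J u2 u4 by apply: before_of_lt u2z u4t (vq4 _ _ qz v4t).
  case: (before_total Jg d04) => b04; exfalso.
    have [s ? ?] := between_meets (gs g23) g34 n0 b20 b04.
    by apply: d03; exists s.
  exact/d14/(between_meets g12 (gs g01) n4 b24 b04).
Qed.

(** One step leads to a peak or a marked node. From there, either at most three best steps and one
    more step suffice, or a fourth best step exists and gives a peak within distance 5. *)
Lemma peel_dominates u : L u ->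
  exists2 z, reach g 6 u z & peak L l z \/ survivor L l z.
Proof.
move=> Lu; have [w uw] := max_nbr_peak_or_marked Lu.
have u1w : reach g 1 u w.
  by case: uw => _ [->|?]; [exact: reach_refl|exact: reach_edge].
move=> [wp|m0].
  by exists w; [exact: (reach_leq _ u1w)|left].
suff [z wz zP] : exists2 z, reach g 5 w z & peak L l z \/ survivor L l z.
  by exists z => //; apply: (reach_trans u1w wz).
have [[z ? ?]|[u1 b01]] := best_or_done m0.
  by exists z => //; apply: (@reach_leq g 1).
have [[m1 g01 _ _] _] := b01.
have r1 : reach g 1 w u1 by exact: reach_edge.
have [[z /(reach_trans r1) ? ?]|[u2 b12]] := best_or_done m1.
  by exists z => //; apply: (@reach_leq g 2).
have [[m2 g12 _ _] _] := b12.
have r2 : reach g 2 w u2 by right; exists u1.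
have [[z /(reach_trans r2) ? ?]|[u3 b23]] := best_or_done m2.
  by exists z => //; apply: (@reach_leq g 3).
have [[m3 g23 _ _] _] := b23.
have r3 : reach g 3 w u3 by right; exists u2.
have [[z /(reach_trans r3) ? ?]|[u4 b34]] := best_or_done m3.
  by exists z => //; apply: (@reach_leq g 4).
have [z ? ?] := long_chain_peak m0 b01 b12 b23 b34.
by exists z => //; left.
Qed.

End Step.
End Peeling.

(** * Centers and their locality *)

Lemma level_leq g i j x : i <= j -> (level g j).1 x -> (level g i).1 x.
Proof.
elim: j => [|j IH]; first by rewrite leqn0 => /eqP ->.
by rewrite leq_eqVlt => /orP[/eqP -> //|/IH + [[Lx _ _] _ _]]; apply.
Qed.

Section Levels.
Variables (R : realType) (J : nat -> set R) (g : nat -> nat -> Prop) (B : nat).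
Hypothesis Jg : represents J g.
Hypothesis gB : forall x y, g x y -> x < B.

Lemma level_inv i :
  [/\ forall x, (level g i).1 x -> (level g i).2 x < iter i (up_log 2) B,
      forall x y, (level g i).1 x -> (level g i).1 y -> g x y ->
        (level g i).2 x <> (level g i).2 y &
      forall x, (level g i).1 x -> J x !=set0].
Proof.
elim: i => [|i [lB lp Ln]].
  split=> [x [y /gB]//|x y _ _ /Jg.2[]//|x [y /Jg.2[_ [s [xs _]]]]].
  by exists s.
split=> [x [[Lx np _] _ _]|x y|x [[/Ln]]//].
  by apply: (new_label_lt lB) => //; rewrite up_logP.
exact: (survivor_proper Jg lp).
Qed.

Lemma level_empty i x : iter i (up_log 2) B = 0 -> ~ (level g i).1 x.
Proof. by move=> iB; have [lB _ _] := level_inv i; move=> /lB; rewrite iB. Qed.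

(** On one level, labels form a proper colouring; across levels, a survivor has no adjacent peak, so
    neighbours of a center never reach later levels. *)
Lemma center_indep x y : center g x -> center g y -> ~ g x y.
Proof.
have lt_case i j u v : i < j -> level_peak g i u -> level_peak g j v -> ~ g v u.
  by move=> ij up [/(level_leq ij)[_ vmax _] _]; apply: vmax.
move=> [i xi] [j yj]; case: (ltngtP i j) => ij.
- by move=> /(rep_sym Jg); apply: lt_case xi yj.
- exact: lt_case yj xi.
- by have [_ lp _] := level_inv i; rewrite -ij in yj; exact: (peak_indep Jg lp xi yj).
Qed.

Lemma center_dominates T u : iter T (up_log 2) B = 0 -> (exists y, g u y) ->
  exists2 z, reach g (6 * T) u z & center g z.
Proof.
move=> TB uy.
suff H d i v : i + d = T -> (level g i).1 v ->
    exists2 z, reach g (6 * d) v z & center g z.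
  exact: (H T 0).
elim: d i v => [|d IH] i v; first by rewrite addn0 => -> /(level_empty TB).
rewrite addnS -addSn => idT Lv; have [lB lp Ln] := level_inv i.
have [z vz [zp|zs]] := peel_dominates Jg lB Ln Lv.
  by exists z; [apply: reach_leq vz; lia|exists i].
have [w zw wc] := IH _ _ idT zs.
by exists w => //; rewrite mulnS; apply: reach_trans vz zw.
Qed.

End Levels.

(** Equality of adjacency at all nodes at distance less than d, unfolded one step at a time to suit
    induction on levels. *)
Fixpoint similar (g h : nat -> nat -> Prop) (d x : nat) : Prop :=
  if d is e.+1 then
    [/\ similar g h e x, forall y, g x y <-> h x y &
        forall y, g x y -> similar g h e y]
  else True.

Lemma similar_leq g h d e x : d <= e -> similar g h e x -> similar g h d x.
Proof.
elim: e => [|e IH]; first by rewrite leqn0 => /eqP ->.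
by rewrite leq_eqVlt => /orP[/eqP -> //|/IH de [/de]].
Qed.

Section StepLocality.
Variables (g h : nat -> nat -> Prop).
Variables (L K : nat -> Prop) (l k : nat -> nat) (d : nat).
Hypothesis LK : forall x, similar g h d x -> (L x <-> K x).
Hypothesis lk : forall x, similar g h d x -> l x = k x.

Lemma closed_nbhd_similar u x : similar g h d.+1 u ->
  closed_nbhd g L u x <-> closed_nbhd h K u x.
Proof.
move=> [su gh sd]; split=> -[Lx [xu|ux]]; split; try (by left); try (by right; apply/gh).
- by rewrite xu; apply/LK => //; rewrite -xu.
- by apply/LK => //; exact: sd.
- by rewrite xu; apply/LK => //; rewrite -xu.
- by apply/LK => //; apply: sd; apply/gh.
Qed.

Lemma label_similar u x : similar g h d.+1 u -> closed_nbhd g L u x -> l x = k x.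
Proof. by move=> [su gh sd] [_ [->|/sd]]; apply: lk. Qed.

Lemma max_label_similar u : similar g h d.+1 u ->
  max_label g L l u = max_label h K k u.
Proof.
move=> su; rewrite /max_label; congr xget; apply/seteqP; split=> n /= [[x ux xn] nmax].
  split; first by exists x; [exact/closed_nbhd_similar|rewrite -(label_similar su ux)].
  by move=> y /(closed_nbhd_similar _ su) uy; rewrite -(label_similar su uy) nmax.
move/(closed_nbhd_similar _ su): ux => ux.
split; first by exists x => //; rewrite (label_similar su ux).
by move=> y uy; rewrite (label_similar su uy) nmax //; exact/closed_nbhd_similar.
Qed.

Lemma peak_similar u : similar g h d.+1 u -> peak g L l u <-> peak h K k u.
Proof.
move=> su; have [su' _ _] := su; rewrite /peak (lk su'); split=> -[Lu umax]; split.
- exact/LK.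
- move=> x /(closed_nbhd_similar _ su) ux.
  by rewrite -(label_similar su ux) umax.
- exact/LK.
- move=> x ux; rewrite (label_similar su ux) umax //.
  exact/closed_nbhd_similar.
Qed.

Lemma new_label_similar u : similar g h d.+1 u ->
  new_label g L l u = new_label h K k u.
Proof.
by move=> su; rewrite /new_label (max_label_similar su) lk //; case: su.
Qed.

Lemma marked_similar u : similar g h d.+2 u -> marked g L l u <-> marked h K k u.
Proof.
move=> su; have [su1 gh sg] := su; have [su0 _ _] := su1.
have sv v : closed_nbhd g L u v -> similar g h d.+1 v by move=> [_ [->|/sg]].
split=> -[Lu up [v uv vmax]]; split.
- exact/LK.
- by move/(peak_similar su1).
- exists v; first exact/closed_nbhd_similar.
  move=> x /(closed_nbhd_similar _ (sv _ uv)) vx.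
  by rewrite -(lk su0) -(label_similar (sv _ uv) vx) vmax.
- exact/LK.
- by move/(peak_similar su1).
- move/(closed_nbhd_similar _ su1): uv => uv.
  exists v => // x vx; rewrite (lk su0) (label_similar (sv _ uv) vx) vmax //.
  by apply/(closed_nbhd_similar _ (sv _ uv)).
Qed.

(** One unit pays for looking at neighbours' marks, one for the witnesses of those marks, one for
    the neighbourhoods of the witnesses. *)
Lemma survivor_similar u : similar g h d.+3 u ->
  survivor g L l u <-> survivor h K k u.
Proof.
move=> su; have [su2 gh sg] := su; have [su1 _ _] := su2; have [su0 _ _] := su1.
split=> -[mu up umax]; split.
- exact/marked_similar.
- move=> x + /gh ux; have [sx _ _] := sg _ ux.
  by move=> /(peak_similar sx)/up; apply.
- move=> x + /gh ux; have [sx _ _] := sg _ ux; have [sx0 _ _] := sx.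
  move=> /(marked_similar (sg _ ux)) mx.
  rewrite -(new_label_similar sx) -(new_label_similar su1) -(lk sx0) -(lk su0).
  exact: umax.
- exact/marked_similar.
- move=> x + ux; have [sx _ _] := sg _ ux.
  by move=> /(peak_similar sx)/up + ; apply; apply/gh.
- move=> x + ux; have [sx _ _] := sg _ ux; have [sx0 _ _] := sx.
  move=> /(marked_similar (sg _ ux)) mx.
  rewrite (new_label_similar sx) (new_label_similar su1) (lk sx0) (lk su0).
  by apply: umax => //; apply/gh.
Qed.

End StepLocality.

Lemma level_similar g h i x : similar g h (3 * i).+1 x ->
  ((level g i).1 x <-> (level h i).1 x) /\ (level g i).2 x = (level h i).2 x.
Proof.
elim: i x => [|i IH] x.
  by move=> [_ gh _]; split => //; split=> -[y /gh xy]; exists y.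
rewrite mulnS !addSn add0n => sx.
have IH1 y : similar g h (3 * i).+1 y -> _ := fun s => (IH y s).1.
have IH2 y : similar g h (3 * i).+1 y -> _ := fun s => (IH y s).2.
split; first exact: (survivor_similar IH1 IH2).
by apply: (new_label_similar IH1 IH2); apply: similar_leq sx; rewrite !ltnS !leqW.
Qed.

Lemma level_peak_similar g h i x : similar g h (3 * i).+2 x ->
  level_peak g i x <-> level_peak h i x.
Proof.
by apply: peak_similar => y /level_similar[].
Qed.

(** Only [g] is an interval graph with bounded names. Level T of [h] misses [x] because it agrees
    there with level T of [g], which is empty; lower levels agree outright. *)
Lemma center_similar (R : realType) (J : nat -> set R) g h B T x :
  represents J g -> (forall x y, g x y -> x < B) ->
  iter T (up_log 2) B = 0 -> similar g h (3 * T).+2 x ->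
  center g x <-> center h x.
Proof.
move=> Jg gB TB sx.
have si i : i <= T -> similar g h (3 * i).+2 x.
  by move=> iT; apply: similar_leq sx; rewrite !ltnS leq_mul2l.
have sT : similar g h (3 * T).+1 x by apply: similar_leq sx.
split=> -[i xi]; have [iT|/ltnW Ti] := leqP i T.
- by exists i; apply/(level_peak_similar (si i iT)).
- by have [/(level_leq Ti)/(level_empty Jg gB TB)] := xi.
- by exists i; apply/(level_peak_similar (si i iT)).
- by have [/(level_leq Ti)/(level_similar sT).1/(level_empty Jg gB TB)] := xi.
Qed.

Definition agree (g h : nat -> nat -> Prop) (n x : nat) : Prop :=
  forall y, reach g n x y -> forall z, g y z <-> h y z.

Lemma agree_leq g h m n x : m <= n -> agree g h n x -> agree g h m x.
Proof. by move=> mn gh y /(reach_leq mn)/gh. Qed.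

Lemma agree_reach g h n m x y : agree g h n x -> m <= n.+1 ->
  reach g m x y <-> reach h m x y.
Proof.
move=> gh; elim: m y => [|m IH] y mn //=.
have IHm z := IH z (ltnW mn).
split=> -[/IHm|[z]]; try (by left).
  by move=> xz zy; right; exists z; [exact/IHm|apply/gh => //; apply: reach_leq xz].
by move=> /IHm xz zy; right; exists z => //; apply/gh => //; apply: reach_leq xz.
Qed.

Lemma agree_shift g h m n x y : agree g h (m + n) x -> reach g m x y ->
  agree g h n y.
Proof. by move=> gh xy z yz; apply: gh; apply: reach_trans xy yz. Qed.

Lemma agree_similar g h k d x : agree g h (k * d) x ->
  similar (power g k) (power h k) d x.
Proof.
elim: d x => [|d IH] x //; rewrite mulnS => gh; split.
- by apply: IH; apply: agree_leq gh; rewrite leq_addl.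
- move=> y; rewrite /power (agree_reach y gh) //.
  by rewrite ltnW // ltnS leq_addr.
- by move=> y [_ xy]; apply: IH; apply: agree_shift gh xy.
Qed.

(** * Cutting along cliques through centers *)

Lemma seq_argmax (R : realType) (f : nat -> R) (x0 : nat) (s : seq nat) :
  exists2 x, x \in x0 :: s & forall y, y \in x0 :: s -> (f y <= f x)%R.
Proof.
elim: s => [|z s [x xs xmax]].
  by exists x0; rewrite ?mem_head // => y; rewrite inE => /eqP ->.
have [zx|xz] := leP (f z) (f x).
  exists x => [|y]; first by move: xs; rewrite !inE => /orP[]->; rewrite ?orbT.
  rewrite !inE => /or3P[/eqP ->|/eqP -> //|ys]; apply: xmax.
    exact: mem_head.
  by rewrite inE ys orbT.
exists z => [|y]; first by rewrite !inE eqxx orbT.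
rewrite !inE => /or3P[/eqP ->|/eqP -> //|ys]; apply: le_trans (ltW xz).
  by apply: xmax; exact: mem_head.
by apply: xmax; rewrite inE ys orbT.
Qed.

(** Intervals may be open, so left ends are replaced by points [m u] of [J u] that have a point of
    every other interval to their right or at them. The largest [m u] is a common point. *)
Lemma helly (R : realType) (J : nat -> set R) (s : seq nat) :
  (forall x, is_interval (J x)) ->
  (forall x y, x \in s -> y \in s -> J x `&` J y !=set0) ->
  exists p, forall x, x \in s -> J x p.
Proof.
case: s => [|x0 s]; first by exists 0%R.
move=> Jint; set S := x0 :: s => meet.
have low u : exists m, u \in S ->
    J u m /\ forall v, v \in S -> exists2 z, J v z & (m <= z)%R.
  have [uS|_] := boolP (u \in S); last by exists 0%R.
  have /choice[f fP] : forall v, exists z, v \in S -> J u z /\ J v z.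
    move=> v; have [vS|_] := boolP (v \in S); last by exists 0%R.
    by have [z [? ?]] := meet u v uS vS; exists z.
  have [v vS vmin] := seq_argmax (fun v => - f v)%R x0 s.
  exists (f v) => _; split=> [|w wS]; first by have [] := fP v vS.
  exists (f w); first by have [] := fP w wS.
  by rewrite -lerN2 vmin.
have /choice[m mP] := low.
have [u uS umax] := seq_argmax m x0 s.
exists (m u) => w wS; have [Jm _] := mP w wS.
have [_ /(_ w wS)[z Jz mz]] := mP u uS.
by apply: (Jint w _ _ Jm Jz); rewrite umax.
Qed.

(* The maximal clique obtained by scanning the nodes by increasing name. *)
Fixpoint clique_upto (g : nat -> nat -> Prop) (c n y : nat) : Prop :=
  if n is m.+1 then
    clique_upto g c m y \/ (y = m /\ forall z, clique_upto g c m z -> g z y)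
  else y = c.

Definition clique g c y := exists n, clique_upto g c n y.

Lemma clique_upto_leq g c m n y : m <= n -> clique_upto g c m y ->
  clique_upto g c n y.
Proof.
elim: n => [|n IH]; first by rewrite leqn0 => /eqP ->.
by rewrite leq_eqVlt => /orP[/eqP -> //|mn /(IH mn)]; left.
Qed.

Lemma clique_self g c : clique g c c.
Proof. by exists 0. Qed.

Lemma clique_upto_nbr g c n y : clique_upto g c n y -> y = c \/ g c y.
Proof.
elim: n y => [|n IH] y /=; first by left.
move=> [/IH //|[_ H]]; right; apply: H.
exact: (clique_upto_leq (leq0n n)).
Qed.

Lemma clique_nbr g c y : clique g c y -> y = c \/ g c y.
Proof. by move=> [n /clique_upto_nbr]. Qed.

Lemma clique_adj g c y z : (forall u v, g u v -> g v u) ->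
  clique g c y -> clique g c z -> y = z \/ g y z.
Proof.
move=> gs [m ym] [n zn].
have {ym zn} : clique_upto g c (maxn m n) y /\ clique_upto g c (maxn m n) z.
  by split; [exact: clique_upto_leq (leq_maxl m n) ym|
             exact: clique_upto_leq (leq_maxr m n) zn].
elim: (maxn m n) => [|k IH] /=; first by move=> [-> ->]; left.
move=> [[yk|[-> yk]] [zk|[-> zk]]]; [exact: IH|right; exact: zk| |by left].
by right; apply/gs/yk.
Qed.

(** The scan examines [w] at stage [w], when all members found so far are adjacent to it. *)
Lemma clique_maximal g c w :
  (forall z, clique g c z -> z = w \/ g z w) -> clique g c w.
Proof.
move=> wz; have [ww|ww] := pselect (clique_upto g c w w); first by exists w.
exists w.+1; right; split => // z zw.
by case: (wz z) => [|zE|//]; [exists w|case: ww; rewrite -{2}zE].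
Qed.

(** The bound makes the clique a finite list, Helly's theorem yields the point, and maximality gives
    the converse. *)
Lemma clique_point (R : realType) (J : nat -> set R) g B c :
  represents J g -> (forall x y, g x y -> x < B) -> (exists y, g c y) ->
  exists p, forall y, clique g c y <-> J y p.
Proof.
move=> Jg gB cy; have gs := rep_sym Jg.
have [s sP] : exists s : seq nat, forall y, (y \in s) <-> clique g c y.
  exists [seq y <- iota 0 B | `[< clique g c y >]] => y.
  rewrite mem_filter mem_iota add0n; split=> [/andP[/asboolP]//|yc].
  apply/andP; split; first exact/asboolP.
  case: (clique_nbr yc) => [->|/gs/gB //].
  by have [z /gB] := cy.
have [|p pP] := helly (s := s) Jg.1.
  move=> x y /sP xc /sP yc; have [->|/Jg.2[]//] := clique_adj gs xc yc.
  have [z /gs /Jg.2[_ [t [_ ?]]]] : exists z, g y z.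
    have [->//|/gs] := clique_nbr yc.
    by exists c.
  by exists t.
exists p => y; split=> [/sP/pP //|yp]; apply: clique_maximal => z /sP/pP zp.
exact: rep_edge zp yp.
Qed.

Section Solution.
Variables (g : nat -> nat -> Prop) (q : nat).

(** The shape r + r.+1 of [power_represents] with r = 2 q: balls of radius 2 q around distinct
    centers are disjoint and joined by no edge. *)
Definition spacing := 2 * q + (2 * q).+1.

(** For positive q, eccentricity at least 2 q. Around other centers there is no room for q + 1 nodes
    to pay for a cut, but their connected component is small enough without one. *)
Definition far c := exists2 y, reach g (2 * q) c y & ~ reach g (2 * q).-1 c y.

Definition cut x := exists c, [/\ center (power g spacing) c, far c & clique g c x].

Definition uncut_edge x y := [/\ g x y, ~ cut x & ~ cut y].

Definition component x y := exists n, reach uncut_edge n x y.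

Definition indep_list (C : nat -> Prop) (s : seq nat) :=
  [/\ uniq s, forall x, x \in s -> C x &
      forall x y, x \in s -> y \in s -> ~ g x y].

Definition max_indep_list (C : nat -> Prop) (s : seq nat) :=
  indep_list C s /\ forall t, indep_list C t -> size t <= size s.

(** [xget] depends only on the set of maximum lists, so nodes of one component pick the same
    list. *)
Definition optimal_list (C : nat -> Prop) : seq nat :=
  xget [::] [set s | max_indep_list C s].

(** An isolated node joins at once, so that a one-node graph is settled in 0 rounds, as log* 1 = 0
    demands. *)
Definition solution x :=
  (forall y, ~ g x y) \/ (~ cut x /\ x \in optimal_list (component x)).

Lemma component_refl x : component x x.
Proof. by exists 0. Qed.

Lemma component_step x y z : component x y -> uncut_edge y z -> component x z.
Proof. by move=> [n xy] yz; exists n.+1; right; exists y. Qed.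

Lemma component_reach x y : component x y -> exists n, reach g n x y.
Proof.
move=> [n]; elim: n y => [|n IH] y /=; first by exists 0.
move=> [/IH//|[z /IH[m xz] [zy _ _]]].
by exists m.+1; right; exists z.
Qed.

(** With no node at distance 2 q, the ball of radius 2 q - 1 is closed under adjacency. *)
Lemma not_far_reach c n y : 0 < q -> ~ far c -> reach g n c y ->
  reach g (2 * q).-1 c y.
Proof.
move=> q0 nf; elim: n y => [|n IH] y /=; first by move=> <-; exact: reach_refl.
move=> [/IH//|[z /IH cz zy]]; apply: contrapT => ny; apply: nf; exists y => //.
have -> : 2 * q = (2 * q).-1.+1 by lia.
by right; exists z.
Qed.

Lemma reach_switch (e : nat -> nat -> Prop) (P Q : nat -> Prop) n x y :
  (forall z, reach e n x z -> P z \/ Q z) -> P x -> Q y -> reach e n x y ->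
  exists a b, [/\ reach e n x a, reach e n x b, P a, Q b & a = b \/ e a b].
Proof.
elim: n y => [|n IH] y PQ Px Qy /=.
  by move=> xy; exists x, y; rewrite -xy; split => //; rewrite ?xy//; left.
have IHn z : Q z -> reach e n x z -> exists a b,
    [/\ reach e n.+1 x a, reach e n.+1 x b, P a, Q b & a = b \/ e a b].
  move=> Qz xz; have [|a [b [xa xb Pa Qb ab]]] := IH z _ Px Qz xz.
    by move=> w xw; apply: PQ; left.
  by exists a, b; split => //; left.
move=> [|[z xz zy]]; first exact: IHn.
have [|Pz|Qz] := PQ z; first by left.
  by exists z, y; split => //; [left|right; exists z|right].
exact: IHn Qz xz.
Qed.

End Solution.

Section Diameter.
Variables (R : realType) (J : nat -> set R) (g : nat -> nat -> Prop) (q B T : nat).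
Hypothesis q0 : 0 < q.
Hypothesis Jg : represents J g.
Hypothesis gB : forall x y, g x y -> x < B.
Hypothesis TB : iter T (up_log 2) B = 0.

Let gs := rep_sym Jg.
Let k := spacing q.
Let D := k * (6 * T).

Lemma power_lt x y : power g k x y -> x < B.
Proof.
move=> [xy /(reach_sym gs) yx].
by have [z /gs/gB] := reach_last_edge yx (nesym xy).
Qed.

Lemma center_nonisolated c : center (power g k) c -> exists y, g c y.
Proof.
move=> [i [/(level_leq (leq0n i)) [y [cy /(reach_sym gs) yc]] _]].
by have [z /gs] := reach_last_edge yc (nesym cy); exists z.
Qed.

Lemma center_near u : (exists y, g u y) ->
  exists2 c, reach g D u c & center (power g k) c.
Proof.
move=> [y uy].
have [|z uz zc] := center_dominates (power_represents Jg (2 * q)) power_lt TB (u := u).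
  exists y; split; first by have [] := (Jg.2 u y).1 uy.
  by apply: (@reach_leq g 1); [rewrite /spacing; lia|exact: reach_edge].
by exists z => //; exact: reach_power.
Qed.

Definition left_of (s : R) x := forall t, J x t -> (s < t)%R.
Definition right_of (s : R) x := forall t, J x t -> (t < s)%R.

Lemma left_or_right s x : ~ J x s -> left_of s x \/ right_of s x.
Proof.
move=> xs; have [|nl] := pselect (left_of s x); [by left|right => t xt].
move: nl => /existsNP[t' /not_implyP[xt' /negP]]; rewrite -leNgt => t's.
rewrite ltNge; apply/negP => st; apply: xs.
exact: (rep_convex Jg xt' xt).
Qed.

Lemma component_uncut v u : component g q v u -> v = u \/ (~ cut g q v /\ ~ cut g q u).
Proof.
move=> [n]; elim: n u => [|n IH] u /=; first by left.
move=> [/IH //|[z /IH vz [_ zc uc]]]; right; split => //.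
by case: vz => [->|[]].
Qed.

Lemma component_side v u s : (forall w, component g q v w -> ~ J w s) ->
  component g q v u ->
  (left_of s v -> left_of s u) /\ (right_of s v -> right_of s u).
Proof.
move=> avoid [n]; elim: n u => [|n IH] u; first by move=> /= <-.
move=> vu; have us := avoid u (ex_intro _ n.+1 vu).
case: vu => [/IH //|[z /IH [zl zr] [/(rep_meet Jg)[t zt ut] _ _]]].
split=> [/zl/(_ t zt) st|/zr/(_ t zt) ts]; case: (left_or_right us) => // H.
  by have := lt_trans st (H t ut); rewrite ltxx.
by have := lt_trans ts (H t ut); rewrite ltxx.
Qed.

(** If some node connected to [v] is not far, its small ball contains everything. Otherwise each
    node [w] of the component is within D of a center whose clique is a point avoided by the
    component, on the left or on the right of [v]. Nodes of the same kind are within 2 D + 1; a walk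
    from [v] to [u] changes kind between equal or adjacent nodes, whence 2 (2 D + 1) + 1. *)
Lemma component_diameter v u : component g q v u -> reach g (4 * D + 3 + 4 * q) v u.
Proof.
move=> vu; have [<-|nvu] := pselect (v = u); first exact: reach_refl.
have [n0 vu0] := component_reach vu.
have [[c [nf [m cv]]]|allfar] :=
  pselect (exists c, ~ far g q c /\ exists m, reach g m c v).
  have cu := not_far_reach q0 nf (reach_trans cv vu0).
  have := reach_trans (reach_sym gs (not_far_reach q0 nf cv)) cu.
  by apply: reach_leq; lia.
apply: (@reach_leq g (4 * D + 3)); first by rewrite leq_addr.
have v_uncut : ~ cut g q v by case: (component_uncut vu) => [/nvu|[]].
have uncut w : component g q v w -> ~ cut g q w.
  by move=> /component_uncut[<-//|[]].
have nonisol w : component g q v w -> exists y, g w y.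
  move=> [n vw]; have [<-|] := pselect (v = w).
    have [z /gs] := reach_last_edge (reach_sym gs vu0) (nesym nvu).
    by exists z.
  move=> /(reach_last_edge vw)[z [/gs ? _ _]].
  by exists z.
pose near w c s := [/\ center (power g k) c, reach g D w c, far g q c &
  forall y, clique g c y <-> J y s].
have nearP w : component g q v w -> exists c s, near w c s.
  move=> vw; have [c wc cc] := center_near (nonisol w vw).
  have [s sP] := clique_point Jg gB (center_nonisolated cc).
  exists c, s; split => //; apply: contrapT => nf; apply: allfar.
  have [n vwn] := component_reach vw.
  exists c; split => //; exists (D + n).
  exact: reach_trans (reach_sym gs wc) (reach_sym gs vwn).
have avoid w c s x : near w c s -> component g q v x -> ~ J x s.
  by move=> [cc _ cf sP] /uncut xc /sP xs; apply: xc; exists c.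
pose side (P : R -> nat -> Prop) w := exists c s, near w c s /\ P s v.
have sideP w : component g q v w -> side left_of w \/ side right_of w.
  move=> vw; have [c [s ws]] := nearP w vw.
  have := left_or_right (avoid _ _ _ _ ws (component_refl g q v)).
  by case=> sv; [left|right]; exists c, s.
(* The walk from [w] to its center passes over the point [s'], hence within one step of the center
   [c'] of [w']. *)
have close1 w w' c s c' s' : near w c s -> near w' c' s' ->
    (exists2 t, J w t & (s <= s' /\ s' <= t)%R \/ (t <= s' /\ s' <= s)%R) ->
    reach g (2 * D + 1) w w'.
  move=> [cc wc cf sP] [cc' wc' cf' sP'] [t wt st].
  have cs : J c s by apply/sP; exact: clique_self.
  have [|z wz /sP' zs] := reach_cover Jg wc wt cs (s := s'); first by tauto.
  have zc' : reach g 1 z c'.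
    by case: (clique_nbr zs) => [->|/gs]; [left|exact: reach_edge].
  have := reach_trans (reach_trans wz zc') (reach_sym gs wc').
  by apply: reach_leq; lia.
have nonempty w : component g q v w -> J w !=set0.
  by move=> /nonisol[y /Jg.2[_ [t [? _]]]]; exists t.
have closeL w w' : component g q v w -> component g q v w' ->
    side left_of w -> side left_of w' -> reach g (2 * D + 1) w w'.
  move=> vw vw' [c [s [ws sv]]] [c' [s' [ws' sv']]].
  have [t wt] := nonempty w vw; have [t' wt'] := nonempty w' vw'.
  have := (component_side (fun x => avoid _ _ _ x ws') vw).1 sv' t wt.
  have := (component_side (fun x => avoid _ _ _ x ws) vw').1 sv t' wt'.
  move=> /ltW st' /ltW s't; case/orP: (le_total s s') => ss'.
    by apply: (close1 _ _ _ _ _ _ ws ws'); exists t => //; left.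
  apply: (reach_sym gs).
  by apply: (close1 _ _ _ _ _ _ ws' ws); exists t' => //; left.
have closeR w w' : component g q v w -> component g q v w' ->
    side right_of w -> side right_of w' -> reach g (2 * D + 1) w w'.
  move=> vw vw' [c [s [ws sv]]] [c' [s' [ws' sv']]].
  have [t wt] := nonempty w vw; have [t' wt'] := nonempty w' vw'.
  have := (component_side (fun x => avoid _ _ _ x ws') vw).2 sv' t wt.
  have := (component_side (fun x => avoid _ _ _ x ws) vw').2 sv t' wt'.
  move=> /ltW st' /ltW s't; case/orP: (le_total s' s) => ss'.
    by apply: (close1 _ _ _ _ _ _ ws ws'); exists t => //; right.
  apply: (reach_sym gs).
  by apply: (close1 _ _ _ _ _ _ ws' ws); exists t' => //; right.
have vv := component_refl g q v.
have join P Q : (forall w w', component g q v w -> component g q v w' ->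
      P w -> P w' -> reach g (2 * D + 1) w w') ->
    (forall w w', component g q v w -> component g q v w' ->
      Q w -> Q w' -> reach g (2 * D + 1) w w') ->
    (forall w, component g q v w -> P w \/ Q w) -> P v ->
    reach g (4 * D + 3) v u.
  move=> closeP closeQ PQ Pv; case: (PQ u vu) => [Pu|Qu].
    by apply: (reach_leq _ (closeP _ _ vv vu Pv Pu)); lia.
  have [n vun] := vu.
  have [|a [b [va vb Pa Qb ab]]] := reach_switch _ Pv Qu vun.
    by move=> z vz; apply: PQ; exists n.
  have {}va : component g q v a by exists n.
  have {}vb : component g q v b by exists n.
  have ab1 : reach g 1 a b by case: ab => [->|[? _ _]]; [left|exact: reach_edge].
  have := reach_trans (reach_trans (closeP _ _ vv va Pv Pa) ab1) (closeQ _ _ vb vu Qb Qu).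
  by apply: reach_leq; lia.
case: (sideP v vv) => sv; first exact: join closeL closeR sideP sv.
by apply: join closeR closeL _ sv => w /sideP[]; [right|left].
Qed.

End Diameter.

(** * Locality and independence of the solution *)

Lemma clique_upto_agree g h c n y : agree g h 1 c ->
  clique_upto g c n y <-> clique_upto h c n y.
Proof.
move=> gh; elim: n y => [|n IH] y //=.
have row z w : clique_upto g c n z -> g z w <-> h z w.
  move=> cz; apply: gh; case: (clique_upto_nbr cz) => [->|].
    exact: reach_refl.
  exact: reach_edge.
split=> -[/IH|[-> H]]; try (by left); right; split=> // z.
  by move=> /IH cz; apply/row => //; exact: H.
by move=> cz; apply/row => //; apply/H/IH.
Qed.

Section Locality.
Variables (R : realType) (J : nat -> set R) (g h : nat -> nat -> Prop).
Variables (q B T : nat).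
Hypothesis q0 : 0 < q.
Hypothesis Jg : represents J g.
Hypothesis gB : forall x y, g x y -> x < B.
Hypothesis TB : iter T (up_log 2) B = 0.
Hypothesis hs : forall x y, h x y -> h y x.

Let gs := rep_sym Jg.
Let k := spacing q.
(** [W] bounds the weak diameter of a component; [N] is a radius that settles whether a node is a
    far center and what its clique is. *)
Let W := 4 * (k * (6 * T)) + 3 + 4 * q.
Let N := k * (3 * T).+2 + 2 * q + 1.

Lemma cut_agree x : agree g h N.+1 x -> cut g q x <-> cut h q x.
Proof.
move=> gh.
(* The extra unit in [N.+1] is the step from [x] to the center of its clique. *)
have nbr c : x = c \/ g c x \/ h c x -> agree g h N c.
  move=> xc; apply: (@agree_shift g h 1 N x); first by rewrite add1n.
  case: xc => [->|[/gs|/hs]]; first exact: reach_refl.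
    exact: reach_edge.
  by move=> ?; apply: reach_edge; apply/(gh x) => //; exact: reach_refl.
have centerE c : agree g h N c -> center (power g k) c <-> center (power h k) c.
  move=> ghc; apply: (center_similar (power_represents Jg (2 * q))) TB _.
    exact: power_lt Jg gB.
  by apply: agree_similar; apply: agree_leq ghc; rewrite /N -addnA leq_addr.
have farE c : agree g h N c -> far g q c <-> far h q c.
  move=> ghc; have E m y : m <= 2 * q -> reach g m c y <-> reach h m c y.
    by move=> mq; apply: (agree_reach y ghc); rewrite /N; lia.
  have [E1 E2] := (fun y => E _ y (leqnn _), fun y => E _ y (leq_pred _)).
  by split=> -[y /E1 cy ncy]; exists y => // /E2.
have cliqueE c : agree g h N c -> clique g c x <-> clique h c x.
  move=> ghc; have gh1 : agree g h 1 c by apply: agree_leq ghc; rewrite /N; lia.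
  by split=> -[n /(clique_upto_agree n x gh1) ?]; exists n.
split=> -[c [cc fc xc]]; have ghc : agree g h N c by
  apply: nbr; case: (clique_nbr xc); tauto.
  by exists c; split; [apply/centerE|apply/farE|apply/cliqueE].
by exists c; split; [apply/centerE|apply/farE|apply/cliqueE].
Qed.

(** A walk in either graph is followed edge by edge: it stays in the component for [g], hence within
    W of [v], where edges and cuts agree. *)
Lemma component_agree v u : agree g h (W + N.+2) v ->
  component g q v u <-> component h q v u.
Proof.
move=> gh.
have edgeE x y : component g q v x -> uncut_edge g q x y <-> uncut_edge h q x y.
  move=> vx; have vWx := component_diameter q0 Jg gB TB vx.
  have ghx := agree_shift gh vWx.
  have gxy := ghx x (reach_refl _ _ _) y.
  have cx := cut_agree (agree_leq (leqnSn _) ghx).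
  have cy : g x y -> cut g q y <-> cut h q y.
    move=> xy; apply: cut_agree; apply: (@agree_shift g h 1 _ x).
      by rewrite add1n.
    exact: reach_edge.
  by split=> -[xy nx ny]; (have /cy ? : g x y by tauto); split; tauto.
split=> -[n]; elim: n u => [|n IH] u /=.
- by move=> ->; exact: component_refl.
- move=> [/IH//|[z vz zu]]; apply: component_step (IH _ vz) _.
  by apply/edgeE => //; exists n.
- by move=> ->; exact: component_refl.
- move=> [/IH//|[z /IH vz /(edgeE _ _ vz) zu]].
  exact: component_step vz zu.
Qed.

Lemma solution_agree v : agree g h (W + N.+2) v ->
  solution g q v <-> solution h q v.
Proof.
move=> gh.
have compE : component g q v = component h q v.
  by apply/funext => u; apply/propext/component_agree.
have row x y : component g q v x -> g x y <-> h x y.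
  move=> /(component_diameter q0 Jg gB TB) vx; apply: gh.
  by apply: reach_leq vx; exact: leq_addr.
have optE : optimal_list g (component g q v) = optimal_list h (component h q v).
  rewrite /optimal_list -compE; congr xget; apply/funext => s; apply/propext.
  have indE t : indep_list g (component g q v) t <-> indep_list h (component g q v) t.
    split=> -[ut tC tI]; split => // x y xt yt /(row x y (tC x xt)) ?;
      exact: (tI x y).
  by rewrite /= /max_indep_list; split=> -[/indE sI smax]; split=> // t /indE/smax.
rewrite /solution -optE cut_agree; last by apply: agree_leq gh; rewrite -addn1; lia.
have vrow y := row v y (component_refl g q v).
by split=> -[iso|?]; (try by right); left=> y /vrow; exact: iso.
Qed.

End Locality.

Lemma solution_isolated g h q v : agree g h 0 v -> (forall y, ~ g v y) ->
  solution g q v /\ solution h q v.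
Proof.
by move=> gh iso; split; left=> // y /(gh v (erefl _)); exact: iso.
Qed.

Section Independence.
Variables (R : realType) (J : nat -> set R) (g : nat -> nat -> Prop) (q B : nat).
Hypothesis Jg : represents J g.
Hypothesis gB : forall x y, g x y -> x < B.

Let gs := rep_sym Jg.

Lemma component_sym x y : component g q x y -> component g q y x.
Proof.
move=> [n xy]; exists n; apply: reach_sym xy.
by move=> u v [/gs ? ? ?].
Qed.

Lemma component_trans x y z : component g q x y -> component g q y z ->
  component g q x z.
Proof. by move=> [m xy] [n yz]; exists (m + n); apply: reach_trans xy yz. Qed.

Lemma component_eq x y : component g q x y -> component g q x = component g q y.
Proof.
move=> xy; apply/funext => z; apply/propext; split; apply: component_trans => //.
exact: component_sym.
Qed.

Lemma component_lt x y : component g q x y -> y = x \/ y < B.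
Proof.
move=> [n xy]; have [->|/(reach_last_edge xy)[z [/gs/gB ? _ _]]] := pselect (x = y).
  by left.
by right.
Qed.

(** A component consists of [x] and names below B, so independent lists have bounded length and a
    longest one exists. *)
Lemma optimal_listP x :
  max_indep_list g (component g q x) (optimal_list g (component g q x)).
Proof.
rewrite /optimal_list; case: xgetP => [_ -> //|noP]; exfalso.
have bound t : indep_list g (component g q x) t -> size t < B.+2.
  move=> [ut tC _]; rewrite ltnS.
  have -> : B.+1 = size (x :: iota 0 B) by rewrite /= size_iota.
  apply: uniq_leq_size => // y /tC /component_lt; rewrite inE mem_iota add0n.
  by case=> [->|->]; rewrite ?eqxx ?orbT.
suff [s sI smax] : exists2 s, indep_list g (component g q x) s &
    forall t, indep_list g (component g q x) t -> size t <= size s.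
  by apply: (noP s); split.
have [||n [s [sI sn]] nmax] := @ex_bounded_max
    (fun n => exists s, indep_list g (component g q x) s /\ size s = n) id B.+2.
- by exists 0, [::]; split => //; split.
- by move=> n [s [/bound + <-]].
by exists s => // t tI; rewrite sn; apply: nmax; exists t.
Qed.

(** Adjacent uncut nodes share their component, hence also the independent list chosen for it. *)
Lemma solution_indep x y : solution g q x -> solution g q y -> ~ g x y.
Proof.
move=> [iso|[xc xo]]; first by move=> _ /iso.
move=> [iso /gs/iso //|[yc yo] xy].
have xyC : component g q x y by exists 1; apply: reach_edge.
have [[_ _ ind] _] := optimal_listP x.
by apply: ind xy => //; rewrite (component_eq xyC).
Qed.

End Independence.

(** * Approximation ratio *)

Local Close Scope classical_set_scope.

Definition id_graph (H : finType) (e : rel H) (ids : H -> nat) (a b : nat) : Prop :=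
  exists u v, [/\ ids u = a, ids v = b & e u v].

Section FiniteGraph.
Variables (R : realType) (H : finType) (e : rel H) (ids : H -> nat).
Hypothesis ids_inj : injective ids.
Hypothesis e_interval : interval_graph R e.

Let g := id_graph e ids.

Lemma id_graphE u v : g (ids u) (ids v) <-> e u v.
Proof.
by split=> [[u' [v' [/ids_inj -> /ids_inj ->]]]|uv]; last by exists u, v.
Qed.

(** Numbers that are no ID receive the empty interval. *)
Lemma id_graph_represents : exists J : nat -> set R, represents J g.
Proof.
have [J [Jint Je]] := e_interval.
exists (fun a => [set s | exists2 u, ids u = a & J u s]%classic); split.
  move=> a s t [u <- us] [v /ids_inj -> vt] r rst.
  by exists u => //; apply: (Jint u _ _ us vt).
move=> a b; split=> [[u [v [<- <- /Je[uv [s [us vs]]]]]]|[ab [s [[u ua us] [v vb vs]]]]].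
  by split=> [/ids_inj//|]; exists s; split; [exists u|exists v].
exists u, v; split => //; apply/Je; split; last by exists s.
by move=> uv; apply: ab; rewrite -ua -vb uv.
Qed.

Lemma id_graph_vertex a b : g a b -> exists v, ids v = b.
Proof. by move=> [u [v [_ <- _]]]; exists v. Qed.

Lemma reach_vertex n u b : reach g n (ids u) b -> exists v, ids v = b.
Proof.
move=> ub; have [<-|] := pselect (ids u = b); first by exists u.
by move=> /(reach_last_edge ub)[z /id_graph_vertex].
Qed.

End FiniteGraph.

Lemma layer_exists g c n m y : reach g m.+1 c y -> ~ reach g m c y -> n <= m ->
  exists2 z, reach g n.+1 c z & ~ reach g n c z.
Proof.
elim: m y => [|m IH] y my nmy; first by rewrite leqn0 => /eqP ->; exists y.
rewrite leq_eqVlt => /orP[/eqP ->|]; first by exists y.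
case: my => [//|[z cz zy]]; apply: (IH z cz) => cz'.
by apply: nmy; right; exists z.
Qed.

(** The sphere of radius n around c. *)
Definition layer (g : nat -> nat -> Prop) (c n y : nat) : Prop :=
  reach g n c y /\ forall m, m < n -> ~ reach g m c y.

Lemma far_layer g q c i : far g q c -> i <= q -> exists y, layer g c (2 * i) y.
Proof.
move=> [y cy ncy]; case: i => [|i] iq; first by exists c; split => //; exact: reach_refl.
have E : 2 * q = (2 * q).-1.+1 by lia.
rewrite E in cy; have [||z cz ncz] := @layer_exists g c (2 * i).+1 _ y cy.
- exact: ncy.
- by lia.
exists z; rewrite mulnS; split => // m mi cz'; apply: ncz.
by apply: reach_leq cz'; lia.
Qed.

Section Approximation.
Variables (R : realType) (H : finType) (e : rel H) (ids : H -> nat) (q : nat).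
Hypothesis q0 : 0 < q.
Hypothesis ids_inj : injective ids.
Hypothesis e_interval : interval_graph R e.

Let g := id_graph e ids.
Let sol := [set v | `[< solution g q (ids v) >]].
Let centers := [set c | `[< center (power g (spacing q)) (ids c) /\ far g q (ids c) >]].

Lemma centersP c : reflect (center (power g (spacing q)) (ids c) /\ far g q (ids c))
  (c \in centers).
Proof. by rewrite inE; exact: asboolP. Qed.

Lemma id_graph_bound : exists B, forall x y, g x y -> x < B.
Proof.
exists (\max_v ids v).+1 => x y [u [v [<- _ _]]]; rewrite ltnS.
exact: leq_bigmax.
Qed.

(** Each far center contributes one node at each of the distances 0, 2, ..., 2 q. Nodes of one
    center are nonadjacent since their distances differ by at least 2, those of different centers by
    the spacing. *)
Lemma centers_bound : #|centers| * q.+1 <= independence_number e.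
Proof.
have [J Jg] := id_graph_represents ids_inj e_interval; have gs := rep_sym Jg.
have [B gB] := id_graph_bound.
have /choice[f fP] : forall p : H * 'I_q.+1, exists y : H, p.1 \in centers ->
    layer g (ids p.1) (2 * p.2) (ids y).
  move=> [c i] /=; have [|_] := boolP (c \in centers); last by exists c.
  move=> /centersP[_ /far_layer /(_ (ltn_ord i))[y cy]].
  by have [v vy] := reach_vertex cy.1; exists v; rewrite vy.
have apart p p' : p.1 \in centers -> p'.1 \in centers -> p <> p' ->
    f p <> f p' /\ ~ g (ids (f p)) (ids (f p')).
  move=> pc p'c pp'; have [lp lp'] := (fP p pc, fP p' p'c).
  have [cc|cc] := pselect (p.1 = p'.1).
    have ii : (p.2 : nat) <> p'.2.
      move=> ii; apply: pp'.
      by case: p p' cc ii {pc p'c lp lp'} => [c i] [c' i'] /= -> /ord_inj ->.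
    have step (r r' : H * 'I_q.+1) : layer g (ids r.1) (2 * r.2) (ids (f r)) ->
        layer g (ids r.1) (2 * r'.2) (ids (f r')) -> r.2 < r'.2 ->
        f r <> f r' /\ ~ g (ids (f r)) (ids (f r')).
      move=> [cr _] [_ ncr'] rr'; split=> [E|E].
        by apply: (ncr' (2 * r.2)); [lia|rewrite -E].
      by apply: (ncr' (2 * r.2).+1); [lia|right; exists (ids (f r))].
    rewrite -cc in lp'.
    case: (ltngtP p.2 p'.2) => // lt; first exact: step.
    rewrite cc in lp lp'; have [E nE] := step p' p lp' lp lt.
    by split=> [/esym|/gs].
  suff nr : ~ reach g 1 (ids (f p)) (ids (f p')).
    by split=> [E|E]; apply: nr; [rewrite E; exact: reach_refl|exact: reach_edge].
  move=> r1; have [[/centersP[cp _] /centersP[cp' _]]] := (pc, p'c).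
  have Pg := power_represents Jg (2 * q).
  apply: (center_indep Pg (power_lt Jg gB) cp cp'); split=> [/ids_inj//|].
  (* 2 q + 1 + 2 q steps would make the two centers adjacent in the power. *)
  have := reach_trans (reach_trans lp.1 r1) (reach_sym gs lp'.1).
  by apply: reach_leq; rewrite /spacing; have := ltn_ord p.2; have := ltn_ord p'.2; lia.
pose D := finset.setX centers [set: 'I_q.+1].
have DP p : p \in D -> p.1 \in centers by case: p => c i; rewrite finset.in_setX => /andP[].
have f_inj : {in D &, injective f}.
  move=> p p' /DP pc /DP p'c E; apply: contrapT => pp'.
  by have [] := apart _ _ pc p'c pp'.
have <- : #|f @: D| = #|centers| * q.+1.
  by rewrite card_in_imset // cardsX cardsT card_ord.
apply: (@leq_bigmax_cond _ _ (fun S : {set H} => #|S|)).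
apply/forall_inP => u /imsetP[p /DP pc ->]; apply/forall_inP => v /imsetP[p' /DP p'c ->].
apply/negP => /(id_graphE e ids_inj) gpp'; have [E|pp'] := pselect (p = p').
  by rewrite E in gpp'; have [] := (Jg.2 _ _).1 gpp'.
by have [] := apart _ _ pc p'c pp'.
Qed.

(** Sending a cut node to a center whose clique contains it is injective on [S], since a clique
    holds at most one node of [S]. *)
Lemma cut_part_bound (S : {set H}) : independent e S ->
  #|[set x in S | `[< cut g q (ids x) >]]| <= #|centers|.
Proof.
move=> Sind; have [J Jg] := id_graph_represents ids_inj e_interval.
have gs := rep_sym Jg.
have /choice[f fP] : forall x : H, exists c : H, cut g q (ids x) ->
    c \in centers /\ clique g (ids c) (ids x).
  move=> x; have [[c [cc cf cx]]|] := pselect (cut g q (ids x)); last by exists x.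
  have [v vc] : exists v, ids v = c.
    by have [y /gs/id_graph_vertex] := center_nonisolated Jg cc.
  by exists v => _; rewrite vc; split => //; apply/centersP; rewrite vc.
rewrite -(card_in_imset (f := f)).
  apply/subset_leq_card/fintype.subsetP => c /imsetP[x]; rewrite inE => /andP[_ /asboolP xc] ->.
  by have [] := fP x xc.
move=> x y; rewrite !inE => /andP[xS /asboolP xc] /andP[yS /asboolP yc] E.
have [[_ cx] [_ cy]] := (fP x xc, fP y yc); rewrite -E in cy.
case: (clique_adj gs cx cy) => [/ids_inj//|/(id_graphE e ids_inj) xy].
by move: Sind => /forall_inP/(_ x xS)/forall_inP/(_ y yS); rewrite xy.
Qed.

(** A node depending only on the component of [v], used to split cardinalities by component. *)
Let rep (v : H) : H :=
  odflt v [pick w | `[< component g q (ids v) (ids w) >]].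

Lemma rep_component v : component g q (ids v) (ids (rep v)).
Proof.
rewrite /rep; case: pickP => [w /asboolP//|/(_ v)/asboolP[]].
exact: component_refl.
Qed.

Lemma rep_eq v w : rep v = rep w <-> component g q (ids v) (ids w).
Proof.
have [J Jg] := id_graph_represents ids_inj e_interval.
split=> [E|vw].
  apply: (component_trans (rep_component v)); rewrite E.
  exact/(component_sym Jg)/rep_component.
rewrite /rep (component_eq Jg vw); case: pickP => // /(_ w)/asboolP[].
exact: component_refl.
Qed.

Lemma uncut_part_bound (S : {set H}) : independent e S ->
  #|[set x in S | ~~ `[< cut g q (ids x) >]]| <= #|sol|.
Proof.
move=> Sind; set A := [set _ in _ | _].
have [J Jg] := id_graph_represents ids_inj e_interval.
have [B gB] := id_graph_bound.
rewrite -!sum1_card (partition_big rep predT) //.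
rewrite [X in _ <= X](partition_big rep predT) //.
apply: leq_sum => r _; rewrite !sum1dep_card.
have [->|[x]] := set_0Vmem [set x in A | rep x == r].
  by rewrite cards0.
rewrite !inE => /andP[/andP[xS /asboolP xc] /eqP xr].
set C := component g q (ids x).
have [[optu optC _] optmax] := optimal_listP q Jg gB (ids x).
set s := optimal_list g (component g q (ids x)) in optu optC optmax.
apply: (@leq_trans (size s)).
  rewrite cardE -(size_map ids); apply: optmax; split.
  - by rewrite (map_inj_uniq ids_inj) enum_uniq.
  - move=> a /mapP[y]; rewrite mem_enum inE => /andP[_ /eqP yr] ->.
    by apply/rep_eq; rewrite xr yr.
  - move=> a b /mapP[y yA ->] /mapP[z zA ->] /(id_graphE e ids_inj) yz.
    move: yA zA; rewrite !mem_enum !inE => /andP[/andP[yS _] _] /andP[/andP[zS _] _].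
    by move: Sind => /forall_inP/(_ y yS)/forall_inP/(_ z zS); rewrite yz.
rewrite cardE -(size_map ids); apply: uniq_leq_size => // a as_.
have xa := optC a as_; have [n xan] := component_reach xa.
have [y ya] := reach_vertex xan; apply/mapP; exists y => //.
rewrite -{}ya in as_ xa *; rewrite mem_enum inE; apply/andP; split; last first.
  by rewrite -xr; apply/eqP/rep_eq/(component_sym Jg).
rewrite inE; apply/asboolP; right; split; last by rewrite -(component_eq Jg xa).
by case: (component_uncut xa) => [<-//|[]].
Qed.

Lemma solution_independent : independent e sol.
Proof.
have [J Jg] := id_graph_represents ids_inj e_interval.
have [B gB] := id_graph_bound.
apply/forall_inP => u; rewrite inE => /asboolP us.
apply/forall_inP => v; rewrite inE => /asboolP vs.
by apply/negP => /(id_graphE e ids_inj); exact: (solution_indep Jg gB us vs).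
Qed.

Lemma solution_approx : independence_number e * q <= q.+1 * #|sol|.
Proof.
have /(eq_bigmax_cond (fun S : {set H} => #|S|))[S Sind SE] :
    0 < #|[pred S : {set H} | independent e S]|.
  apply/card_gt0P; exists finset.set0; rewrite inE; apply/forall_inP => u.
  by rewrite inE.
have cb := centers_bound.
have : independence_number e <= #|sol| + #|centers|.
  rewrite /independence_number SE.
  rewrite -(cardsID [set x | `[< cut g q (ids x) >]] S) addnC.
  apply: leq_add.
    apply: leq_trans (uncut_part_bound Sind).
    by apply/subset_leq_card/fintype.subsetP => x; rewrite !inE andbC.
  apply: leq_trans (cut_part_bound Sind).
  by apply/subset_leq_card/fintype.subsetP => x; rewrite !inE.
(* From a <= n + m and m (q + 1) <= a follows (q + 1) a <= (q + 1) n + a. *)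
move: cb; set a := independence_number e; set m := #|centers|; set n := #|sol|.
nia.
Qed.

End Approximation.

(** * Iterated logarithms *)

Lemma iter_up_log0 j m : m <= j -> iter j (up_log 2) m = 0.
Proof.
elim: j m => [|j IH] m; first by rewrite leqn0 => /eqP.
move=> mj; rewrite iterSr; apply: IH.
case: m mj => [|m] mj; first by rewrite up_log0.
have mS : up_log 2 m.+1 <= m by apply: up_log_min => //; exact: ltn_expl.
exact: leq_trans mS _.
Qed.

Section LogStar.
Local Open Scope ring_scope.
Variable R : realType.

Let ln2_gt0 : 0 < ln 2 :> R.
Proof. by rewrite ln_gt0 ?ltr1n. Qed.

Lemma log2M (x y : R) : 0 < x -> 0 < y -> log2 (x * y) = log2 x + log2 y.
Proof. by move=> x0 y0; rewrite /log2 lnM ?posrE // mulrDl. Qed.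

Lemma log2_exp2 a : log2 ((2 ^ a)%N%:R : R) = a%:R.
Proof. by rewrite /log2 natrX lnXn ?ltr0n // -[ln 2 *+ a]mulr_natl mulfK ?gt_eqF. Qed.

Lemma ler_log2 (x y : R) : 0 < x -> x <= y -> log2 x <= log2 y.
Proof.
move=> x0 xy; rewrite /log2 ler_pM2r ?invr_gt0 // ler_ln ?posrE //.
exact: lt_le_trans xy.
Qed.

Lemma log2_gt0 (x : R) : 1 < x -> 0 < log2 x.
Proof. by move=> x1; rewrite /log2 divr_gt0 // ln_gt0. Qed.

Lemma up_log_le m : (0 < m)%N -> (up_log 2 m)%:R <= log2 (m%:R : R) + 1.
Proof.
move=> m0; case E : (up_log 2 m) => [|d].
  rewrite addr_ge0 // -[0](log2_exp2 0) ler_log2 // ?ler_nat ?ltr0n //.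
rewrite -natr1 lerD2r -(log2_exp2 d) ler_log2 ?ltr0n ?expn_gt0 // ler_nat ltnW //.
rewrite ltnNge; apply/negP => md.
by have := up_log_min (isT : (1 < 2)%N) md; rewrite E ltnn.
Qed.

(** The rounded iteration [b] stays below A (y + 1), with [y] the real one. When [y] drops to at
    most 1, [b] is at most 2 A, and 2 A further steps bring it to 0. *)
Lemma iter_up_log_log_star c : exists A, forall n, (1 < n)%N ->
  iter (log_star R n + A) (up_log 2) (n ^ c).+1 = 0%N.
Proof.
(* For y > 1, log2 (A (y + 1)) + 1 <= a + 2 + log2 y, so a + 2 <= A preserves the invariant; c <= A
   serves the first step. *)
pose a := c.+2; pose A := (2 ^ a)%N.
have aA : (a.+2 <= A)%N.
  by rewrite /A /a !expnS; have := ltn_expl c (isT : (1 < 2)%N); lia.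
have Ac : (c <= A)%N by rewrite /a in aA; lia.
exists (2 * A)%N => n n1.
pose y i := iter i (@log2 R) n%:R; pose b i := iter i (up_log 2) (n ^ c).+1.
have [k [yk kmin] ->] : exists2 k, y k <= 1 /\ forall i, (i < k)%N -> 1 < y i &
    log_star R n = k.
  rewrite /log_star; case: ex_minnP => k yk kmin; exists k => //; split=> // i ik.
  by rewrite ltNge; apply/negP => /kmin; rewrite leqNgt ik.
have y0 : y 0%N = n%:R by [].
have yS i : y i.+1 = log2 (y i) by [].
have k0 : (0 < k)%N.
  by case: k yk {kmin} => //; rewrite y0 lern1 leqNgt n1.
have A1 : 1 <= A%:R :> R by rewrite ler1n; lia.
have bound i : (i < k)%N -> (b i.+1)%:R <= A%:R * (y i.+1 + 1).
  elim: i => [|i IH] ik.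
    have yp : 0 < y 1%N by rewrite yS log2_gt0 // kmin.
    apply: le_trans (up_log_le _) _ => //.
    have nc0 : 0 < (n ^ c)%N%:R :> R by rewrite ltr0n expn_gt0 ltnW.
    have : log2 ((n ^ c).+1%:R : R) <= 1 + c%:R * y 1%N.
      have -> : 1 + c%:R * y 1%N = log2 ((2 ^ 1)%N%:R * (n ^ c)%N%:R).
        rewrite log2M ?ltr0n ?expn_gt0 ?(ltnW n1) // (log2_exp2 1); congr +%R.
        by rewrite mulr_natl yS y0 /log2 natrX lnXn ?ltr0n ?(ltnW n1) // mulrnAl.
      rewrite ler_log2 ?ltr0n // -natrM ler_nat expn1 mul2n -addnn -addn1 leq_add2l.
      by rewrite expn_gt0 ltnW.
    have : c%:R * y 1%N <= A%:R * y 1%N by rewrite ler_pM2r // ler_nat.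
    have : (2 : R) <= A%:R by rewrite ler_nat; rewrite /a in aA; lia.
    lra.
  have {}IH := IH (ltnW ik).
  have y1 := kmin _ ik; have yp := log2_gt0 y1; rewrite -yS in yp.
  have [b0|b0] := posnP (b i.+1).
    by rewrite /b iterS -/(b i.+1) b0 up_log0 mulr_ge0 // addr_ge0 // ltW.
  apply: le_trans (up_log_le b0) _.
  have bl : log2 (b i.+1)%:R <= a.+1%:R + y i.+2.
    rewrite yS -(log2_exp2 a.+1) -log2M ?ltr0n ?expn_gt0 ?(lt_trans ltr01) //.
    apply: ler_log2; rewrite ?ltr0n // (le_trans IH) // expnS -/A natrM mulrAC.
    rewrite -[X in X <= _]mulrC ler_pM2r ?(lt_le_trans ltr01) //.
    lra.
  have : (a.+2%:R : R) <= A%:R by rewrite ler_nat.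
  have : y i.+2 <= A%:R * y i.+2 by rewrite ler_peMl // ltW.
  rewrite -(natr1 a.+1); lra.
rewrite addnC iterD iter_up_log0 // -(ler_nat R).
have := bound k.-1; rewrite prednK // => /(_ (leqnn _)) /le_trans; apply.
rewrite mulrC natrM ler_pM2r ?(lt_le_trans ltr01) //; lra.
Qed.

Lemma log_star_gt0 n : (1 < n)%N -> (0 < log_star R n)%N.
Proof.
move=> n1; rewrite /log_star; case: ex_minnP => -[|//] /=.
by rewrite lern1 leqNgt n1.
Qed.

End LogStar.

(** * Deciding from a local view *)

Section Simulation.
Variable F : (nat -> nat -> Prop) -> nat -> Prop.

Record knowledge := Knowledge {
  own_id : nat;
  round : nat;
  known_edges : nat -> nat -> Prop;
  decision : option bool
}.

(** The graphs considered need not be interval graphs: [solution_agree] compares with every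
    symmetric [h]. *)
Definition determined (a t : nat) (K : nat -> nat -> Prop) (b : bool) : Prop :=
  forall h : nat -> nat -> Prop, (forall x y, h x y -> h y x) ->
  (forall x y, K x y <-> reach h t a x /\ h x y) -> (F h a <-> b).

Definition decide a t K : option bool :=
  if `[< determined a t K true >] then Some true
  else if `[< determined a t K false >] then Some false else None.

Definition sim_init (a : nat) (nbrs : seq nat) : knowledge :=
  let K x y := x = a /\ y \in nbrs in Knowledge a 0 K (decide a 0 K).

Definition sim_receive (s : knowledge) (inbox : seq (nat * (nat -> nat -> Prop))) :=
  let K x y := foldr (fun m P => m.2 x y \/ P) (known_edges s x y) inbox in
  Knowledge (own_id s) (round s).+1 K
    (if decision s is Some b then Some b else decide (own_id s) (round s).+1 K).

Lemma sim_stable s inbox b :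
  decision s = Some b -> decision (sim_receive s inbox) = Some b.
Proof. by move=> /= ->. Qed.

Definition simulation : local_algorithm :=
  LocalAlgorithm sim_init (fun s _ => known_edges s) sim_stable.

(** Each further step of a walk from [a] of length at most t uses an edge in the view, so equal
    views give equal balls. *)
Lemma view_agree g h t a :
  (forall x y, reach g t a x /\ g x y <-> reach h t a x /\ h x y) ->
  agree g h t a.
Proof.
have sub (g' h' : nat -> nat -> Prop) :
    (forall x y, reach g' t a x /\ g' x y <-> reach h' t a x /\ h' x y) ->
    forall s x, s <= t -> reach g' s a x -> reach h' s a x.
  move=> gh; elim=> [|s IH] x st //= [|[z az zx]]; first by left; apply: IH => //; exact: ltnW.
  right; exists z; first by apply: IH => //; exact: ltnW.
  have [] // := (gh z x).1; split => //; exact: reach_leq (ltnW st) az.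
move=> gh y ay z; have ay' := sub _ _ gh t y (leqnn t) ay.
split=> yz; first by have [] := (gh y z).1 (conj ay yz).
by have [] := (gh y z).2 (conj ay' yz).
Qed.

Section Correctness.
Variables (H : finType) (e : rel H) (ids : H -> nat).
Hypothesis ids_inj : injective ids.
Hypothesis e_sym : symmetric e.

Let g := id_graph e ids.

Lemma id_graph_sym x y : g x y -> g y x.
Proof. by move=> [u [v [ua vb uv]]]; exists v, u; rewrite e_sym. Qed.

Lemma mem_neighbours v w : (w \in neighbours e ids v) = e v w.
Proof. by rewrite mem_sort mem_enum. Qed.

Lemma id_graph_nbr v a : g (ids v) a <-> exists2 w, w \in neighbours e ids v & ids w = a.
Proof.
split=> [[u [w [/ids_inj -> <- vw]]]|[w]]; first by exists w; rewrite ?mem_neighbours.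
by rewrite mem_neighbours => vw <-; exists v, w.
Qed.

Lemma run_view t v :
  [/\ own_id (run e ids simulation t v) = ids v,
      round (run e ids simulation t v) = t &
      forall x y, known_edges (run e ids simulation t v) x y <->
        reach g t (ids v) x /\ g x y].
Proof.
elim: t v => [|t IH] v.
  split=> // x y /=; split=> [[-> /mapP[w wv ->]]|[<- /id_graph_nbr[w wv <-]]].
    by split => //; apply/id_graph_nbr; exists w.
  by split => //; apply: map_f.
have [vid vround vK] := IH v; split; rewrite /= ?vid ?vround // => x y.
have inbox s : foldr (fun m P => m.2 x y \/ P)
    (known_edges (run e ids simulation t v) x y)
    [seq (ids w, known_edges (run e ids simulation t w)) | w <- s] <->
    known_edges (run e ids simulation t v) x y \/
    exists2 w, w \in s & known_edges (run e ids simulation t w) x y.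
  elim: s => [|w s IHs] /=; first by split=> [|[//|[]//]]; left.
  rewrite IHs; split=> [[wK|[vK'|[w' w's wK]]]|[vK'|[w' + wK]]].
  - by right; exists w; rewrite ?mem_head.
  - by left.
  - by right; exists w'; rewrite // inE w's orbT.
  - by right; left.
  - rewrite inE => /orP[/eqP <-|w's]; first by left.
    by right; right; exists w'.
rewrite inbox vK; split=> [[[vx xy]|[w wv]]|[[vx|] xy]].
- by split => //; left.
- have [_ _ wK] := IH w; rewrite wK => -[wx xy]; split => //.
  suff : reach g (1 + t) (ids v) x by [].
  by apply: reach_trans wx; apply: reach_edge; apply/id_graph_nbr; exists w.
- by left.
- move=> vx; have : reach g (1 + t) (ids v) x by right.
  move=> /reach_split[z vz zx]; case: vz => [->|[_ <- /id_graph_nbr[w wv wz]]].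
    by left.
  by right; exists w => //; have [_ _ wK] := IH w; apply/wK; rewrite wz.
Qed.

(** The real graph is among those consistent with the view, so an answer common to all of them is
    right. *)
Lemma decide_sound t v b :
  decide (ids v) t (known_edges (run e ids simulation t v)) = Some b ->
  b = `[< F g (ids v) >].
Proof.
have [_ _ K] := run_view t v.
have Dg b' : determined (ids v) t (known_edges (run e ids simulation t v)) b' ->
    b' = `[< F g (ids v) >].
  move=> D; have FE := D g id_graph_sym K.
  by apply/idP/asboolP => /FE.
by rewrite /decide; case: asboolP => [/Dg <- [<-]//|_]; case: asboolP => // /Dg <- [].
Qed.

Lemma run_sound t v b :
  la_output (run e ids simulation t v) = Some b -> b = `[< F g (ids v) >].
Proof.
elim: t b => [|t IH] b; first exact: (@decide_sound 0).
have [vid vround _] := run_view t v => /=.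
case E : decision => [b'|] => [[<-]|]; first exact: IH E.
by rewrite vid vround; exact: (@decide_sound t.+1).
Qed.

(** By locality all graphs consistent with the view at round t give the same answer, so one of the
    two tests of [decide] succeeds unless a decision was made earlier. *)
Lemma run_decided t v :
  (forall h : nat -> nat -> Prop, (forall x y, h x y -> h y x) ->
    agree g h t (ids v) -> (F g (ids v) <-> F h (ids v))) ->
  la_output (run e ids simulation t v) = Some `[< F g (ids v) >].
Proof.
move=> Floc; suff : la_output (run e ids simulation t v) <> None.
  by case E : la_output => [b|//] _; rewrite (run_sound E).
have [_ _ K] := run_view t v.
have D : determined (ids v) t (known_edges (run e ids simulation t v)) `[< F g (ids v) >].
  move=> h hs hK; have gh : agree g h t (ids v).
    by apply: view_agree => x y; rewrite -K -hK.
  by rewrite -(Floc h hs gh); split=> /asboolP.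
have dec : decide (ids v) t (known_edges (run e ids simulation t v)) <> None.
  rewrite /decide; case: asboolP => // nt; case: asboolP => // nf.
  by move: D; case: `[< F g (ids v) >].
case: t {Floc K D} dec => [|t] //= dec.
have [vid vround _] := run_view t v.
by case: decision => //; rewrite vid vround.
Qed.

End Correctness.
End Simulation.

Local Open Scope ring_scope.

Theorem theorem21 (R : realType) (c : nat) :
  exists C : R, forall eps : R, 0 < eps ->
  exists A : local_algorithm,
  forall (H : finType) (e : rel H) (ids : H -> nat),
    interval_graph R e -> valid_ids c ids ->
  exists t : nat,
    [/\ t%:R <= C * Num.max 1 eps^-1 * (log_star R #|H|)%:R,
        terminated e ids A t,
        independent e (output_set e ids A t)
      & (independence_number e)%:R
          <= (1 + eps) * #|output_set e ids A t|%:R].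
Proof.
have [A AP] := iter_up_log_log_star R c.
(* The radius of [solution_agree] is at most 160 q (A + 1) log* n, and q <= 2 max (1, 1 / eps). *)
exists (320 * A.+1)%:R => eps eps0.
pose q := (Num.truncn eps^-1).+1.
have q0 : (0 < q)%N by [].
exists (simulation (fun g => solution g q)) => H e ids eint [ids_inj ids_le].
have [J Jg] := id_graph_represents ids_inj eint.
have e_sym : symmetric e.
  move=> u v; apply/idP/idP => /(id_graphE e ids_inj)/(rep_sym Jg);
  exact: (id_graphE e ids_inj _ _).1.
have M1 : 1 <= Num.max 1 eps^-1 by rewrite le_max lexx.
suff [t tle tloc] : exists2 t : nat,
    t%:R <= (320 * A.+1)%:R * Num.max 1 eps^-1 * (log_star R #|H|)%:R &
    forall v (h : nat -> nat -> Prop), (forall x y, h x y -> h y x) ->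
      agree (id_graph e ids) h t (ids v) ->
      (solution (id_graph e ids) q (ids v) <-> solution h q (ids v)).
  have dec v := run_decided (F := fun g => solution g q) ids_inj e_sym (tloc v).
  have outE : output_set e ids (simulation (fun g => solution g q)) t =
      [set v | `[< solution (id_graph e ids) q (ids v) >]].
    by apply/setP => v; rewrite !inE dec; case: asbool.
  exists t; split => //.
  - by move=> v; rewrite dec.
  - by rewrite outE; exact: solution_independent ids_inj eint.
  - rewrite outE; set S := #|_|.
    have : (independence_number e * q <= q.+1 * S)%N.
      exact: solution_approx q0 ids_inj eint.
    rewrite -(ler_nat R) !natrM => aS.
    (* This gives q + 1 <= (1 + eps) q, which turns the integer bound into the ratio. *)
    have qe : 1 <= eps * q%:R.
      by rewrite mulrC -ler_pdivrMr // div1r ltW // truncnS_gt.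
    have q0R : 0 < q%:R :> R by rewrite ltr0n.
    rewrite -(ler_pM2r q0R); apply: le_trans aS _.
    by rewrite mulrAC ler_wpM2r // -natr1 mulrDl mul1r lerD2l.
(* With at most one node the bound on the rounds is 0, and every node is isolated. *)
have [H1|H2] := leqP #|H| 1.
  exists 0%N; first by rewrite !mulr_ge0 // (le_trans ler01).
  move=> v h hs gh.
  have iso y : ~ id_graph e ids (ids v) y.
    move=> [u [w [/ids_inj -> _ /(id_graphE e ids_inj)/Jg.2[vw _]]]].
    by apply: vw; congr ids; move/fintype_le1P: H1; apply.
  by have [? ?] := solution_isolated q gh iso.
pose T := (log_star R #|H| + A)%N.
have TB : iter T (up_log 2) (#|H| ^ c).+1 = 0%N by exact: AP.
have gB x y : id_graph e ids x y -> (x < (#|H| ^ c).+1)%N.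
  by move=> [u [w [<- _ _]]]; rewrite ltnS; have /andP[] := ids_le u.
(* The number of rounds is the radius W + N + 2 of [solution_agree]. *)
eexists; last by move=> v h hs; apply: (solution_agree q0 Jg gB TB hs).
have L0 := log_star_gt0 R H2; rewrite /T; set L := log_star R #|H| in L0 *.
have q2 : q%:R <= 2 * Num.max 1 eps^-1.
  have : eps^-1 <= Num.max 1 eps^-1 by rewrite le_max lexx orbT.
  have einv : 0 <= eps^-1 by rewrite invr_ge0 ltW.
  have /andP[] := truncn_itv einv.
  rewrite -natr1; lra.
apply: (@le_trans _ _ (160 * q * (A.+1 * L))%N%:R).
  rewrite ler_nat /spacing; nia.
have AL0 : 0 <= 160 * A.+1%:R * L%:R :> R by rewrite !mulr_ge0.
by have := ler_wpM2l AL0 q2; rewrite !natrM; lra.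
Qed.
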